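(* Let $M$ be a closed manifold, and let $\pi:S^1\times M\to M$ be the projection. The map $$\mathcal{S}:\mathrm{Cont}(M)\to \mathrm{ISymp}^D(S^1\times M),\qquad \alpha\mapsto \mathcal{S}(\alpha)=D(\pi^*\alpha)=dt\wedge\pi^*\alpha+d(\pi^*\alpha),$$ from the set of contact forms on $M$ to the set of $S^1$-invariant $D$-symplectic forms on $S^1\times M$, is well defined and is a bijection.
   Context: $S^1=\mathbb{R}/2\pi\mathbb{Z}$ acts on $S^1\times M$ by translation on the first factor, and $dt$ is the standard closed $1$-form on $S^1$ pulled back to $S^1\times M$. The twisted differential is $D:\Omega^k(S^1\times M)\to\Omega^{k+1}(S^1\times M)$, $D\beta=dt\wedge\beta+d\beta$. $\mathrm{Cont}(M)$ is the set of contact forms on $M$, i.e. ($\dim M=2n-1$) $1$-forms $\alpha$ with $\alpha\wedge(d\alpha)^{n-1}$ nowhere zero. $\mathrm{ISymp}^D(S^1\times M)$ is the set of $S^1$-invariant non-degenerate $2$-forms $\beta$ on $S^1\times M$ with $D\beta=0$. *)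

(* Defs.v *)
From HB Require Import structures.
From mathcomp Require Import all_boot all_order all_algebra perm.
From mathcomp Require Import generic_quotient.
From mathcomp Require Import all_classical all_reals all_analysis.

Set Implicit Arguments.
Unset Strict Implicit.
Unset Printing Implicit Defensive.

Import Order.TTheory GRing.Theory Num.Theory.
Import numFieldNormedType.Exports.

Local Open Scope classical_set_scope.
Local Open Scope ring_scope.
Local Open Scope quotient_scope.

Section Smooth.
Context {R : realType} {V W : normedModType R}.

(* [f] is total; only its germ along the open set [U] matters *)
Fixpoint C_on (k : nat) (U : set V) (f : V -> W) : Prop :=
  match k with
  | 0 => forall x, U x -> {for x, continuous f}
  | k'.+1 => (forall x, U x -> differentiable f x) /\
             (forall v, C_on k' U (fun x => 'd f x v))
  end.

Definition smooth_on (U : set V) (f : V -> W) : Prop := forall k, C_on k U f.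

End Smooth.

(* A space with one chart around each point.  The set of all these charts is an
   atlas; conversely every smooth structure is the one generated by such an
   atlas (choose a chart around each point).  The chart at [p] also serves to
   identify the tangent space T_pM with R^m.  The charts are total functions,
   meaningful on [cdom p] and, for the inverse, on its image [cimg p].
   The axioms are in [smooth_atlas]. *)
Record charted (R : realType) (m : nat) := Charted {
  carrier :> topologicalType;
  cdom : carrier -> set carrier;
  cmap : carrier -> carrier -> 'rV[R]_m;
  cinv : carrier -> 'rV[R]_m -> carrier }.

Definition cimg (R : realType) (m : nat) (M : charted R m) (p : M) :
  set 'rV[R]_m := cmap p @` cdom p.

Definition smooth_atlas (R : realType) (m : nat) (M : charted R m) : Prop :=
  (forall p : M,
    [/\ cdom p p, open (cdom p), open (cimg p),
        {within cdom p, continuous (cmap p)} &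
        {within cimg p, continuous (@cinv R m M p)}]) /\
  (forall p q : M, cdom p q -> cinv p (cmap p q) = q) /\
  (forall p q : M,
    smooth_on (cmap p @` (cdom p `&` cdom q)) (cmap q \o @cinv R m M p)).

Definition closed_manifold (R : realType) (m : nat) (M : charted R m) : Prop :=
  [/\ smooth_atlas M, hausdorff_space M & compact [set: M]].

(* df_p, read in the identifications of T_pM and T_(f p)N with R^m and R^l *)
Definition tangent (R : realType) (m l : nat) (M : charted R m)
    (N : charted R l) (f : M -> N) (p : M) (v : 'rV[R]_m) : 'rV[R]_l :=
  'd (cmap (f p) \o f \o @cinv R m M p) (cmap p p : 'rV[R]_m) v.

Section Forms.
Context {R : realType} {m : nat} (M : charted R m).

(* arbitrary fields of functions of k tangent vectors; the differential
   k-forms are those satisfying [is_form] *)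
Definition kfield (k : nat) := M -> ('I_k -> 'rV[R]_m) -> R.

(* The pull-back of [w] by the parametrization [cinv p] : cimg p -> M, i.e. the
   expression of [w] in the coordinates of the chart at [p]. *)
Definition in_chart k (w : kfield k) (p : M) (x : 'rV[R]_m)
    (v : 'I_k -> 'rV[R]_m) : R :=
  w (cinv p x) (fun i => 'd (cmap (cinv p x) \o @cinv R m M p) x (v i)).

Definition multilinear k (f : ('I_k -> 'rV[R]_m) -> R) : Prop :=
  forall (v : 'I_k -> 'rV[R]_m) (i : 'I_k) (a : R) (x y : 'rV[R]_m),
    f (dfwith v i (a *: x + y)) = a * f (dfwith v i x) + f (dfwith v i y).

Definition alternating k (f : ('I_k -> 'rV[R]_m) -> R) : Prop :=
  forall (v : 'I_k -> 'rV[R]_m) (i j : 'I_k), i != j -> v i = v j -> f v = 0.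

Definition is_form k (w : kfield k) : Prop :=
  (forall p, multilinear (w p) /\ alternating (w p)) /\
  (forall p v, smooth_on (cimg p) (fun x => in_chart w p x v)).

(* normalized so that (a /\ b)(u, v) = a(u) b(v) - a(v) b(u) for 1-forms *)
Definition wedge k l (a : kfield k) (b : kfield l) : kfield (k + l)%N :=
  fun p v => (k`! * l`!)%:R^-1 *
    \sum_(s : 'S_(k + l)) (-1) ^+ s *
      a p (fun i => v (s (lshift l i))) * b p (fun j => v (s (rshift k j))).

Fixpoint wedge_pow k (w : kfield k) (j : nat) : kfield (j * k)%N :=
  match j with
  | 0 => fun _ _ => 1
  | j'.+1 => wedge w (@wedge_pow k w j')
  end.

(* The exterior derivative, computed at [p] in the chart at [p]:
   dw(v_0, .., v_k) = \sum_i (-1)^i D_(v_i) (w(v_0, .., v_(i-1), v_(i+1), ..))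
   for constant vector fields v_i on R^m. *)
Definition dext k (w : kfield k) : kfield k.+1 :=
  fun p v => \sum_(i < k.+1) (-1) ^+ i *
    'D_(v i) (fun x => in_chart w p x (fun j => v (lift i j))) (cmap p p).

Definition nondegenerate (b : kfield 2) : Prop :=
  forall p u, u != 0 -> exists w, b p (tnth [tuple u; w]) != 0.

End Forms.

Arguments wedge_pow {R m M k} w j _ _.

Definition pullback (R : realType) (m l : nat) (M : charted R m)
    (N : charted R l) (f : M -> N) k (w : kfield N k) : kfield M k :=
  fun p v => w (f p) (fun i => tangent f p (v i)).

(* the set of contact forms on a manifold of dimension 2n - 1, for n > 0 *)
Definition Cont (R : realType) (n : nat) (M : charted R n.*2.-1) :
    set (kfield M 1) :=
  [set a | is_form a /\
    forall p : M, exists v, wedge a (wedge_pow (dext a) n.-1) p v != 0].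

Section Circle.
Variable R : realType.

Definition circle_eq : rel R := fun s t => (s - t) / (2 * pi) \is a Num.int.

Fact circle_eq_refl : reflexive circle_eq.
Proof. by move=> t; rewrite /circle_eq subrr mul0r rpred0. Qed.

Fact circle_eq_sym : symmetric circle_eq.
Proof. by move=> s t; rewrite /circle_eq -opprB mulNr rpredN. Qed.

Fact circle_eq_trans : transitive circle_eq.
Proof.
move=> t s u; rewrite /circle_eq => st tu.
by rewrite -(subrKA t) mulrDl rpredD.
Qed.

Canonical circle_equiv : equiv_rel R :=
  EquivRel circle_eq circle_eq_refl circle_eq_sym circle_eq_trans.

Definition circle_type := quotient_topology {eq_quot circle_equiv}.

Definition to_circle (t : R) : circle_type :=
  \pi_({eq_quot circle_equiv}) t.

Definition of_circle (q : circle_type) : R :=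
  repr (q : {eq_quot circle_equiv}).

Definition circle_add (s q : circle_type) : circle_type :=
  to_circle (of_circle s + of_circle q).

(* the representative of [q] in [r - pi, r + pi[ *)
Definition circle_lift (r : R) (q : circle_type) : R :=
  of_circle q - 2 * pi * (Num.floor ((of_circle q - r + pi) / (2 * pi)))%:~R.

Definition circle : charted R 1 := {|
  carrier := circle_type;
  cdom := fun p => to_circle @` `]of_circle p - pi, of_circle p + pi[;
  cmap := fun p q => const_mx (circle_lift (of_circle p) q);
  cinv := fun p x => to_circle (x ord0 ord0) |}.

(* The standard 1-form dt on the circle: all charts of [circle] are local
   inverses of R -> R/2piZ, so dt is the coordinate of R^1 in each of them. *)
Definition circle_dt : kfield circle 1 := fun _ v => v ord0 ord0 ord0.

End Circle.

Definition prod_charted (R : realType) (m l : nat) (M : charted R m)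
    (N : charted R l) : charted R (m + l)%N := {|
  carrier := (M * N)%type;
  cdom := fun p => cdom p.1 `*` cdom p.2;
  cmap := fun p q => row_mx (cmap p.1 q.1) (cmap p.2 q.2);
  cinv := fun p x => (cinv p.1 (lsubmx x), cinv p.2 (rsubmx x)) |}.

Section SymplecticD.
Context {R : realType} {m : nat} (M : charted R m).

Definition S1xM : charted R (1 + m)%N := prod_charted (circle R) M.

Definition S1_act (s : circle R) (p : S1xM) : S1xM := (circle_add s p.1, p.2).

Definition S1_invariant k (w : kfield S1xM k) : Prop :=
  forall s : circle R, pullback (S1_act s) w = w.

Definition dt : kfield S1xM 1 :=
  pullback (fst : S1xM -> circle R) (@circle_dt R).

Definition Dtw k (b : kfield S1xM k) : kfield S1xM k.+1 :=
  fun p v => wedge dt b p v + dext b p v.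

Definition ISympD : set (kfield S1xM 2) :=
  [set b | [/\ is_form b, S1_invariant b, nondegenerate b &
               forall p v, Dtw b p v = 0]].

Definition Smap (a : kfield M 1) : kfield S1xM 2 :=
  Dtw (pullback (snd : S1xM -> M) a).

End SymplecticD.

Arguments Cont {R n} M.
Arguments ISympD {R m} M.
Arguments Smap {R m} M a.

(* Main.v *)
(* The contraction of b = dt /\ pi^*a + d(pi^*a) with d/dt is pi^*a, so S is
   injective. Conversely, let b be invariant with Db = 0, and let a be its
   contraction with d/dt, which is pulled back from M. Evaluating Db = 0 on
   (d/dt, u, v) with u, v horizontal gives b(u, v) = da(u, v), as the d/dt
   derivative vanishes by invariance; hence b = S(a).

   On R x V with dim V = 2j + 1, the form dt /\ a + w is nondegenerate iff
   a /\ w^j <> 0. If (u0, u) is in its kernel with u <> 0, then a(u) = 0 and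
   w(u, .) = - u0 a, so a /\ w^j vanishes on every basis containing u. If it is
   nondegenerate, w is symplectic on ker a, and all terms of a /\ w^j on a
   symplectic basis of ker a completed by a vector z with a(z) = 1 are
   nonnegative, one of them being positive. *)
Require Import Defs.
From mathcomp Require Import all_boot all_order all_algebra perm generic_quotient.
From mathcomp Require Import all_classical all_reals all_analysis.
From mathcomp Require Import ring lra.

Set Implicit Arguments.
Unset Strict Implicit.
Unset Printing Implicit Defensive.

Import Order.TTheory GRing.Theory Num.Theory.
Import numFieldNormedType.Exports.

Local Open Scope classical_set_scope.
Local Open Scope ring_scope.

(** * Products of a 1-form and powers of a 2-form *)

(** There are two obstacles. The first is combinatorial: [wedge] is a normalized sum over
    permutations, and iterating it nests such sums. They are flattened into one alternating sum over
    [1 + (j + j)] positions, up to a nonzero constant whose value is irrelevant since only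
    non-vanishing is at stake. This sum is a fixed multiple of the determinant of its arguments, so
    vanishing on one basis forces it to vanish identically.

    The second is analytic: [dext] at a point is computed in the chart at that very point, so its
    values at neighbouring points come from different charts. Before [dext a] can be shown smooth,
    or differentiated, it has to be expressed in one fixed chart, and this is where the symmetry of
    second derivatives enters. The same symmetry then gives D(D(pi^*a)) = 0.

    Changes of chart on the circle are locally translations, so they fix d/dt; invariance then says
    that the coefficients of b in a product chart do not depend on t. *)

Section WedgeFormula.
Variables (R : realType) (m : nat).
Local Notation V := 'rV[R]_m.

(** Each [lift_perm ord0 ord0] prepends one fixed point and keeps the sign; [k] of them embed 'S_l
    into 'S_(k + l). *)
Lemma block_perm k l (t : 'S_l) : exists s : 'S_(k + l),
  [/\ forall i, s (lshift l i) = lshift l i,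
      forall j, s (rshift k j) = rshift k (t j) & odd_perm s = odd_perm t].
Proof.
elim: k => [|k [s [sl sr so]]].
  exists t; split=> // [[]//|j].
  have E i : rshift 0 i = i :> 'I_l by apply: val_inj.
  by rewrite !E.
exists (lift_perm ord0 ord0 s : 'S_(k.+1 + l)); split.
- move=> i; case: (unliftP ord0 i) => [i'|] ->.
    have -> : lshift l (lift ord0 i') = lift ord0 (lshift l i') by apply: val_inj.
    by rewrite lift_perm_lift sl; apply: val_inj.
  have -> : lshift l (ord0 : 'I_k.+1) = ord0 by apply: val_inj.
  by rewrite lift_perm_id.
- move=> j; have E i : rshift k.+1 i = lift ord0 (rshift k i) :> 'I_(k.+1 + l).
    by apply: val_inj.
  by rewrite !E lift_perm_lift sr.
- by rewrite odd_lift_perm /= so.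
Qed.

(** Extending an inner permutation [t] by the identity and reindexing [s] by it cancels the sign of
    [t], so the [l]! inner terms all give the same outer sum. This removes the nested alternations
    of an iterated wedge. *)
Lemma alternation_absorb k l (A : ('I_k -> V) -> R) (B : ('I_l -> V) -> R)
    (v : 'I_(k + l) -> V) :
  \sum_(s : 'S_(k + l)) (-1) ^+ s * A (fun i => v (s (lshift l i))) *
    (\sum_(t : 'S_l) (-1) ^+ t * B (fun j => v (s (rshift k (t j))))) =
  l`!%:R * \sum_(s : 'S_(k + l)) (-1) ^+ s * A (fun i => v (s (lshift l i))) *
    B (fun j => v (s (rshift k j))).
Proof.
under eq_bigr do rewrite big_distrr /=.
rewrite exchange_big /= -card_Sn -sumr_const mulr_suml.
apply: eq_big => [t|t _]; first by rewrite inE.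
rewrite mul1r; have [e [el er eo]] := block_perm k t.
rewrite [RHS](reindex_inj (mulgI e)) /=; apply: eq_bigr => s _.
rewrite odd_permM signr_addb eo.
under [X in A X]eq_fun do rewrite -el -permM.
under [X in B X]eq_fun do rewrite -er -permM.
by rewrite !mulrA; congr (_ * _); rewrite mulrC !mulrA.
Qed.

Fact pair_idx_subproof j (i : 'I_j) (b : 'I_2) : (i * 2 + b < j * 2)%N.
Proof. by rewrite -ltn_divLR// divnMDl// divn_small ?addn0. Qed.

(** The positions 2i and 2i + 1, which [wedge_pow] feeds to the [i]-th factor. *)
Definition pair_idx j (i : 'I_j) (b : 'I_2) : 'I_(j * 2) :=
  Ordinal (pair_idx_subproof i b).

Lemma pair_idx_inj j (i i' : 'I_j) b b' :
  pair_idx i b = pair_idx i' b' -> i = i' /\ b = b'.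
Proof.
move=> [E]; have E1 : i = i' :> nat.
  by move: (congr1 (divn^~ 2) E); rewrite !divnMDl// !divn_small ?addn0.
by split; apply: val_inj => //; move: E; rewrite /= E1 => /addnI.
Qed.

Lemma wedge_powE (M : charted R m) (w : kfield M 2) j : exists2 c : R, c != 0 &
  forall p (v : 'I_(j * 2) -> V), wedge_pow w j p v =
    c * \sum_(t : 'S_(j * 2)) (-1) ^+ t *
      \prod_(i < j) w p (fun b => v (t (pair_idx i b))).
Proof.
elim: j => [|j [c c0 IH]].
  exists 1 => [|p v]; first exact: oner_neq0.
  rewrite (big_pred1 (1%g : 'S_(0 * 2))) => [|t]; last first.
    by apply/esym/eqP/permP => -[].
  by rewrite big_ord0 odd_perm1 !mulr1.
exists ((2`! * (j * 2)`!)%:R^-1 * (c * (j * 2)`!%:R)) => [|p v].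
  by rewrite !mulf_neq0// ?invr_neq0// pnatr_eq0 -lt0n ?muln_gt0 !fact_gt0.
rewrite /= /wedge -!mulrA; congr (_ * _).
under eq_bigr do rewrite IH mulrCA.
rewrite -mulr_sumr; congr (_ * _).
rewrite (alternation_absorb (fun u => w p u)
  (fun u => \prod_(i < j) w p (fun b => u (pair_idx i b)))).
congr (_ * _); apply: eq_bigr => s _; rewrite -mulrA; congr (_ * _).
rewrite big_ord_recl; congr (w p _ * _).
  by apply: funext => b; congr (v (s _)); apply: val_inj.
apply: eq_bigr => i _; congr (w p _); apply: funext => b.
by congr (v (s _)); apply: val_inj.
Qed.

Lemma wedge_1_powE (M : charted R m) (a : kfield M 1) (w : kfield M 2) j :
  exists2 c : R, c != 0 & forall p (v : 'I_(1 + j * 2) -> V),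
  wedge a (wedge_pow w j) p v =
    c * \sum_(s : 'S_(1 + j * 2)) (-1) ^+ s *
      (a p (fun i => v (s (lshift _ i))) *
      \prod_(i < j) w p (fun b => v (s (rshift 1 (pair_idx i b))))).
Proof.
have [c c0 E] := wedge_powE w j.
exists ((1`! * (j * 2)`!)%:R^-1 * (c * (j * 2)`!%:R)) => [|p v].
  by rewrite !mulf_neq0// ?invr_neq0// pnatr_eq0 -lt0n ?muln_gt0 !fact_gt0.
rewrite /wedge -!mulrA; congr (_ * _).
under eq_bigr do rewrite E mulrCA.
rewrite -mulr_sumr; congr (_ * _).
rewrite (alternation_absorb (fun u => a p u)
  (fun u => \prod_(i < j) w p (fun b => u (pair_idx i b)))).
by congr (_ * _); apply: eq_bigr => s _; rewrite -mulrA.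
Qed.

End WedgeFormula.

(** * Alternating sums: determinant, vanishing and positivity *)

Section AlternatingSum.
Variables (R : realFieldType) (j : nat).

(** The two arguments of the [i]-th factor w sit in separate halves instead of being adjacent, so
    that a permutation of the pairs becomes a block matrix. *)
Definition lidx (i : 'I_j) : 'I_(1 + (j + j)) := rshift 1 (lshift j i).
Definition ridx (i : 'I_j) : 'I_(1 + (j + j)) := rshift 1 (rshift j i).

Lemma lridx_ind (P : 'I_(1 + (j + j)) -> Prop) :
  P ord0 -> (forall i, P (lidx i)) -> (forall i, P (ridx i)) -> forall k, P k.
Proof.
move=> P0 Pl Pr k; rewrite -(splitK k); case: (fintype.split k) => /= [i|i].
  by have -> : lshift (j + j) i = ord0; [apply: val_inj; case: i => -[]|].
by rewrite -(splitK i); case: (fintype.split i).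
Qed.

Lemma big_lridx (F : 'I_(1 + (j + j)) -> R) :
  \prod_k F k = F ord0 * \prod_(i < j) (F (lidx i) * F (ridx i)).
Proof.
rewrite big_split_ord /= big_ord1 big_split_ord /= big_split /=.
by congr (F _ * _); apply: val_inj.
Qed.

Definition lrcase (T : Type) (z : T) (l r : 'I_j -> T) (k : 'I_(1 + (j + j))) : T :=
  match fintype.split k with
  | inl _ => z
  | inr i => match fintype.split i with inl i => l i | inr i => r i end
  end.

Lemma lrcase0 T (z : T) l r : lrcase z l r ord0 = z.
Proof.
rewrite /lrcase; have -> : ord0 = lshift (j + j) (ord0 : 'I_1) by apply: val_inj.
by case: split_ordP => // k /esym/eqP; rewrite eq_rlshift.
Qed.

Lemma lrcasel T (z : T) l r i : lrcase z l r (lidx i) = l i.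
Proof.
rewrite /lrcase /lidx; case: split_ordP => k /eqP; rewrite ?eq_rlshift// eq_rshift.
move=> /eqP <-; case: split_ordP => k' /eqP; rewrite ?eq_lrshift// eq_lshift.
by move=> /eqP <-.
Qed.

Lemma lrcaser T (z : T) l r i : lrcase z l r (ridx i) = r i.
Proof.
rewrite /lrcase /ridx; case: split_ordP => k /eqP; rewrite ?eq_rlshift// eq_rshift.
move=> /eqP <-; case: split_ordP => k' /eqP; rewrite ?eq_rlshift// eq_rshift.
by move=> /eqP <-.
Qed.

(* [alt_sum a w v] is a nonzero multiple of (a /\ w^j)(v). *)
Definition alt_sum (V : Type) (a : V -> R) (w : V -> V -> R)
    (v : 'I_(1 + (j + j)) -> V) : R :=
  \sum_(s : 'S_(1 + (j + j))) (-1) ^+ s *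
    (a (v (s ord0)) * \prod_(i < j) w (v (s (lidx i))) (v (s (ridx i)))).

Local Notation d := (1 + (j + j))%N.

(** Expanding [a] and [w] in coordinates gives one term for each choice of a coordinate at every
    position. Alternating such a term yields the determinant of the matrix of [v] with its columns
    selected by the choice, hence a multiple of the determinant of [v]. *)
Lemma alt_sum_det (a : 'rV[R]_d -> R) (w : 'rV[R]_d -> 'rV[R]_d -> R)
    (A : 'I_d -> R) (W : 'I_d -> 'I_d -> R) :
  (forall x, a x = \sum_p x 0 p * A p) ->
  (forall x y, w x y = \sum_p \sum_q x 0 p * y 0 q * W p q) ->
  exists K, forall v, alt_sum a w v = K * \det (\matrix_(i, k) v i 0 k).
Proof.
move=> aE wE.
pose g (p : 'I_d) (f : {ffun 'I_j -> 'I_d * 'I_d}) : 'I_d -> 'I_d :=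
  lrcase p (fun i => (f i).1) (fun i => (f i).2).
(* Selecting columns is multiplication by this 0-1 matrix, which turns the inner sum into the
   determinant of a product. *)
pose sel p f : 'M[R]_d := \matrix_(k, x) (x == g p f k)%:R.
exists (\sum_p \sum_(f : {ffun 'I_j -> 'I_d * 'I_d})
  A p * (\prod_i W (f i).1 (f i).2) * \det (sel p f)) => v.
set M := \matrix_(_, _) _.
have wE2 x y : w x y = \sum_(pq : 'I_d * 'I_d) x 0 pq.1 * y 0 pq.2 * W pq.1 pq.2.
  by rewrite wE pair_big.
transitivity (\sum_(s : 'S_d) \sum_p \sum_(f : {ffun 'I_j -> 'I_d * 'I_d})
    A p * (\prod_i W (f i).1 (f i).2) *
    ((-1) ^+ s * \prod_k v (s k) 0 (g p f k))).
  apply: eq_bigr => s _; rewrite aE mulr_suml mulr_sumr; apply: eq_bigr => p _.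
  under eq_bigr do rewrite wE2.
  rewrite bigA_distr_bigA !mulr_sumr; apply: eq_bigr => f _.
  rewrite big_lridx /g lrcase0.
  under [X in _ = _ * (_ * (_ * X))]eq_bigr do rewrite lrcasel lrcaser.
  rewrite [in LHS]big_split /=.
  move: ((-1) ^+ s) (v _ _ _) (\prod_i _) (\prod_i _) => x y z t.
  ring.
rewrite exchange_big mulr_suml; apply: eq_bigr => p _.
rewrite exchange_big mulr_suml; apply: eq_bigr => f _.
rewrite -mulr_sumr -!mulrA; congr (_ * (_ * _)).
rewrite -(det_tr M) -det_mulmx /determinant; apply: eq_bigr => s _.
congr (_ * _); apply: eq_bigr => k _.
rewrite !mxE (bigD1 (g p f k))//= !mxE eqxx mul1r big1 ?addr0// => x xg.
by rewrite !mxE (negbTE xg) mul0r.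
Qed.

(** Sort the permutations by the position [k] that receives [v k0]. In position [ord0] the factor a
    vanishes. In a pair, the factor w becomes a multiple of a at the partner position, so the term
    contains a product of two values of a, symmetric under exchanging the partner with [ord0]. *)
Lemma alt_sum_eq0 (V : Type) (a : V -> R) (w : V -> V -> R) (l : R) v k0 :
  a (v k0) = 0 -> (forall x, w (v k0) x = l * a x) ->
  (forall x, w x (v k0) = - (l * a x)) -> alt_sum a w v = 0.
Proof.
move=> a0 w0 w1; rewrite /alt_sum.
rewrite (partition_big (fun s : 'S_d => (s^-1)%g k0) predT)//=.
apply: big1 => k _.
have kE (s : 'S_d) : ((s^-1)%g k0 == k) = (s k == k0).
  by rewrite -(inj_eq (@perm_inj _ s)) permKV eq_sym.
under eq_bigl do rewrite kE.
(* Swapping the positions [ord0] and [q] changes the sign of each term. *)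
have swap (q : 'I_d) (F : 'S_d -> R) : q != ord0 -> k != ord0 -> k != q ->
    (forall s : 'S_d, s k = k0 -> F (tperm ord0 q * s)%g = F s) ->
    \sum_(s : 'S_d | s k == k0) (-1) ^+ s * F s = 0.
  move=> q0 k_0 kq FE; set S := \sum_(_ | _) _.
  suff SN : S = - S by lra.
  rewrite {1}/S (reindex_inj (mulgI (tperm ord0 q))) /= -sumrN.
  apply: eq_big => [s|s /eqP sk].
    by rewrite permM tpermD// eq_sym.
  rewrite FE ?odd_mul_tperm; first by rewrite eq_sym q0 signr_addb mulN1r mulNr.
  by move: sk; rewrite permM tpermD// eq_sym.
have tp0 q (s : 'S_d) : (tperm ord0 q * s)%g ord0 = s q by rewrite permM tpermL.
have tpq q (s : 'S_d) : (tperm ord0 q * s)%g q = s ord0 by rewrite permM tpermR.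
have tpD q (s : 'S_d) r : r != ord0 -> r != q -> (tperm ord0 q * s)%g r = s r.
  by move=> ? ?; rewrite permM tpermD// eq_sym.
have l0 i : lidx i != ord0 by [].
have r0 i : ridx i != ord0 by [].
have ll i i' : (lidx i == lidx i') = (i == i') by rewrite eq_rshift eq_lshift.
have rr i i' : (ridx i == ridx i') = (i == i') by rewrite !eq_rshift.
have lr i i' : (lidx i == ridx i') = false by rewrite eq_rshift eq_lrshift.
have rl i i' : (ridx i == lidx i') = false by rewrite eq_sym lr.
elim/lridx_ind: k kE swap => [|i|i] kE swap.
- by apply: big1 => s /eqP ->; rewrite a0 mul0r mulr0.
- apply: (swap (ridx i)); rewrite ?r0 ?l0 ?lr// => s sk.
  rewrite tp0 (bigD1 i)//= [in RHS](bigD1 i)//= tpq (tpD _ _ (lidx i)) ?lr//.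
  rewrite sk !w0.
  rewrite (eq_bigr (fun i' => w (v (s (lidx i'))) (v (s (ridx i'))))); first by ring.
  by move=> i' ii'; rewrite !tpD ?rr ?lr.
- apply: (swap (lidx i)); rewrite ?r0 ?l0 ?rl// => s sk.
  rewrite tp0 (bigD1 i)//= [in RHS](bigD1 i)//= tpq (tpD _ _ (ridx i)) ?rl//.
  rewrite sk !w1.
  rewrite (eq_bigr (fun i' => w (v (s (lidx i'))) (v (s (ridx i'))))); first by ring.
  by move=> i' ii'; rewrite !tpD ?ll ?rl.
Qed.

(** Adding the second block row to the first, then subtracting the first block column from the
    second, makes the matrix block triangular. *)
Lemma det_block_sym (P Q : 'M[R]_j) :
  \det (block_mx P Q Q P) = \det (P + Q) * \det (P - Q).
Proof.
have E : block_mx 1%:M 1%:M 0 1%:M *m block_mx P Q Q P *m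
    block_mx 1%:M (- 1%:M) 0 1%:M = block_mx (P + Q) 0 Q (P - Q).
  rewrite !mulmx_block !mul1mx !mul0mx !add0r !mulmx1 !mulmxN !mulmx1 !mulmx0.
  by rewrite !addr0 [Q + P]addrC addNr [- Q + P]addrC.
move: (congr1 determinant E); rewrite !det_mulmx !det_ublock det_lblock.
by rewrite !det1 !mul1r !mulr1.
Qed.

Section Positive.
Variables (V : Type) (a : V -> R) (w : V -> V -> R) (v : 'I_d -> V).
Hypotheses (a0 : a (v ord0) = 1) (al : forall i, a (v (lidx i)) = 0)
  (ar : forall i, a (v (ridx i)) = 0)
  (wll : forall i k, w (v (lidx i)) (v (lidx k)) = 0)
  (wrr : forall i k, w (v (ridx i)) (v (ridx k)) = 0)
  (wlr : forall i k, w (v (lidx i)) (v (ridx k)) = (i == k)%:R)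
  (wrl : forall i k, w (v (ridx i)) (v (lidx k)) = - (i == k)%:R).

(* A permutation with a nonzero term fixes [ord0] and permutes the pairs
   (lidx i, ridx i), possibly reversing some of them; up to the sign of these
   reversals, its signature is the square of that of the permutation of the
   pairs. *)
Lemma alt_sum_term_ge0 (s : 'S_d) : 0 <= (-1) ^+ s *
  (a (v (s ord0)) * \prod_(i < j) w (v (s (lidx i))) (v (s (ridx i)))).
Proof.
have [s0|s0] := eqVneq (s ord0) ord0; last first.
  suff -> : a (v (s ord0)) = 0 by rewrite mul0r mulr0.
  by elim/lridx_ind: (s ord0) s0.
rewrite s0 a0 mul1r; set X := \prod_(i < j) _.
have [->|/prodf_neq0 Xn0] := eqVneq X 0; first by rewrite mulr0.
have sl0 i : s (lidx i) != ord0 by rewrite -s0 inj_eq//; exact: perm_inj.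
have sr0 i : s (ridx i) != ord0 by rewrite -s0 inj_eq//; exact: perm_inj.
(* [f i] records the pair onto which [s] sends the [i]-th pair, and whether it reverses it; any
   other behaviour makes a factor of [X] vanish. *)
have /fin_all_exists[f fE] i : exists p : 'I_j * bool,
    [/\ s (lidx i) = if p.2 then ridx p.1 else lidx p.1,
        s (ridx i) = if p.2 then lidx p.1 else ridx p.1 &
        w (v (s (lidx i))) (v (s (ridx i))) = (-1) ^+ p.2].
  move: (Xn0 i isT) (sl0 i) (sr0 i).
  elim/lridx_ind: (s (lidx i)) => [|k|k]; first by rewrite eqxx.
    elim/lridx_ind: (s (ridx i)) => [|k'|k']; first by rewrite eqxx.
      by rewrite wll eqxx.
    rewrite wlr; case: (eqVneq k k') => [->|] _ /=; last by rewrite mulr0n eqxx.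
    by exists (k', false); split=> //=; rewrite wlr eqxx.
  elim/lridx_ind: (s (ridx i)) => [|k'|k']; first by rewrite eqxx.
    rewrite wrl; case: (eqVneq k k') => [->|] _ /=; last by rewrite mulr0n oppr0 eqxx.
    by exists (k', true); split=> //=; rewrite wrl eqxx.
  by rewrite wrr eqxx.
(* [Y] is the matrix of the map induced on pairs, split into the pairs kept in order ([P]) and the
   reversed ones ([Q]); [e] lists the signs of the reversals, so [P - Q] is [Y] with its rows
   multiplied by [e]. *)
pose P : 'M[R]_j := \matrix_(i, k) (~~ (f i).2 && ((f i).1 == k))%:R.
pose Q : 'M[R]_j := \matrix_(i, k) ((f i).2 && ((f i).1 == k))%:R.
pose Y : 'M[R]_j := \matrix_(i, k) ((f i).1 == k)%:R.
pose e : 'rV[R]_j := \row_i (-1) ^+ (f i).2.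
have sE : perm_mx s = block_mx 1%:M 0 0 (block_mx P Q Q P) :> 'M[R]_d.
  have ll i i' : (lidx i == lidx i') = (i == i') by rewrite eq_rshift eq_lshift.
  have rr i i' : (ridx i == ridx i') = (i == i') by rewrite !eq_rshift.
  have lr i i' : (lidx i == ridx i') = false by rewrite eq_rshift eq_lrshift.
  have rl i i' : (ridx i == lidx i') = false by rewrite eq_sym lr.
  have ord0E : ord0 = lshift (j + j) (ord0 : 'I_1) by apply: val_inj.
  apply/matrixP => i k; rewrite [LHS]mxE [in LHS]mxE.
  elim/lridx_ind: i => [|i|i].
  - rewrite s0; elim/lridx_ind: k => [|k|k].
    + by rewrite [in RHS]ord0E block_mxEul mxE.
    + by rewrite [in RHS]ord0E block_mxEur mxE.
    + by rewrite [in RHS]ord0E block_mxEur mxE.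
  - have [-> _ _] := fE i; elim/lridx_ind: k => [|k|k].
    + by rewrite [in RHS]ord0E block_mxEdl mxE; case: (f i).2.
    + rewrite block_mxEdr block_mxEul mxE; case: (f i).2; first by rewrite rl.
      by rewrite ll.
    + rewrite block_mxEdr block_mxEur mxE; case: (f i).2; first by rewrite rr.
      by rewrite lr.
  - have [_ -> _] := fE i; elim/lridx_ind: k => [|k|k].
    + by rewrite [in RHS]ord0E block_mxEdl mxE; case: (f i).2.
    + rewrite block_mxEdr block_mxEdl mxE; case: (f i).2; first by rewrite ll.
      by rewrite rl.
    + rewrite block_mxEdr block_mxEdr mxE; case: (f i).2; first by rewrite lr.
      by rewrite rr.
have XE : X = \det (diag_mx e).
  rewrite det_diag; apply: eq_bigr => i _; rewrite mxE.
  by have [_ _ ->] := fE i.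
have PQ : P + Q = Y.
  by apply/matrixP => i k; rewrite !mxE; case: (f i).2; rewrite ?add0r ?addr0.
have PNQ : P - Q = diag_mx e *m Y.
  apply/matrixP => i k; rewrite mul_diag_mx !mxE.
  by case: (f i).2; rewrite /= ?sub0r ?subr0 ?mulN1r ?mul1r.
(* The sign of [s] is the determinant of its permutation matrix, and [X] is the determinant of
   [diag_mx e]; multiplied by the remaining factor [X], the term becomes a square. *)
have -> : (-1) ^+ s = \det Y * (X * \det Y).
  by rewrite XE -det_mulmx -PNQ -PQ -det_block_sym -det_perm sE det_ublock det1 mul1r.
have -> : \det Y * (X * \det Y) * X = (\det Y * X) ^+ 2 by ring.
exact: sqr_ge0.
Qed.

Lemma alt_sum_gt0 : 0 < alt_sum a w v.
Proof.
rewrite /alt_sum (bigD1 (1%g : 'S_d))//= ltr_pwDl//.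
  rewrite odd_perm1 !perm1 a0 !mul1r big1 ?ltr01// => i _.
  by rewrite !perm1 wlr eqxx.
by apply: sumr_ge0 => s _; exact: alt_sum_term_ge0.
Qed.

End Positive.

End AlternatingSum.

(** * Symplectic bases of the kernel of a linear form *)

Section SymplecticBasis.
Variables (R : realFieldType) (m j : nat) (A : 'cV[R]_m) (W : 'M[R]_m).
Hypotheses (mE : m = (1 + (j + j))%N) (WT : W^T = - W)
  (nd : forall x : 'rV_m, x != 0 -> x *m A = 0 ->
    exists2 y : 'rV_m, y *m A = 0 & x *m W *m y^T != 0).

Lemma form_antisym (k l : nat) (x : 'M[R]_(k, m)) (y : 'M[R]_(l, m)) :
  x *m W *m y^T = - (y *m W *m x^T)^T.
Proof. by rewrite !trmx_mul trmxK WT mulNmx mulmxN opprK mulmxA. Qed.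

Lemma form_alternating (x : 'rV[R]_m) : x *m W *m x^T = 0.
Proof.
set q := _ *m _; have : q = - q.
  rewrite {1}/q form_antisym; congr (- _); apply/matrixP => i k.
  by rewrite mxE !ord1.
by move=> qE; apply/matrixP => i k; move: (congr1 (fun q : 'M[R]_1 => q i k) qE);
   rewrite !mxE; lra.
Qed.

(** Symplectic Gram-Schmidt, adding one hyperbolic pair ([x], [y]) at a time; the rows of [E] and
    [F] are the vectors found so far. *)
Lemma symplectic_basis i : (i <= j)%N -> exists E F : 'M[R]_(i, m),
  [/\ E *m A = 0, F *m A = 0, E *m W *m E^T = 0, F *m W *m F^T = 0 &
      E *m W *m F^T = 1%:M].
Proof.
elim: i => [|i IH] ij.
  by exists 0, 0; split; apply/matrixP => -[].
have [E [F [EA FA EE FF EF]]] := IH (ltnW ij).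
have FE : F *m W *m E^T = - 1%:M by rewrite form_antisym EF trmx1.
(* The left kernel of [N] consists of the vectors of ker a orthogonal to all rows of [E] and [F]. It
   is nonzero because [N] has 1 + 2i columns and 1 + 2j > 1 + 2i rows. *)
pose N := row_mx A (row_mx (W *m E^T) (W *m F^T)).
have [x x0 xN] : exists2 x : 'rV_m, x != 0 & x *m N = 0.
  have /rowV0Pn[x /sub_kermxP xN x0] : kermx N != 0; last by exists x.
  rewrite kermx_eq0; apply/negP => /eqP rN.
  by have := rank_leq_col N; rewrite rN mE leq_add2l !addnn leq_double leqNgt ij.
move: xN; rewrite !mul_mx_row !mulmxA -[0]hsubmxK => /eq_row_mx[xA].
rewrite linear0 -[RHS]hsubmxK => /eq_row_mx[].
move: xA; rewrite !linear0 => xA xE xF.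
have [y0 y0A xy0] := nd x0 xA.
pose c := (x *m W *m y0^T) 0 0.
have c0 : c != 0.
  apply: contraNneq xy0 => c0; apply/eqP/matrixP => k l; rewrite !ord1.
  by rewrite -/c c0 mxE.
pose y1 := c^-1 *: y0.
(* Removes from [y1] its components along [E] and [F]; the pairing with [x] is unchanged, as [x] is
   orthogonal to both. *)
pose y := y1 - y1 *m W *m F^T *m E + y1 *m W *m E^T *m F.
have Ex : E *m W *m x^T = 0 by rewrite form_antisym xE trmx0 oppr0.
have Fx : F *m W *m x^T = 0 by rewrite form_antisym xF trmx0 oppr0.
have xy1 : x *m W *m y1^T = 1%:M.
  rewrite /y1 linearZ /= -scalemxAr; apply/matrixP => k l; rewrite !ord1.
  by rewrite [RHS]mxE eqxx -[RHS](mulVf c0) [LHS]mxE.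
have WE k (B : 'M[R]_(k, i)) (G H : 'M[R]_(i, m)) :
    B *m G *m W *m H^T = B *m (G *m W *m H^T) by rewrite !mulmxA.
have yE : y *m W *m E^T = 0.
  rewrite /y !(mulmxDl, mulNmx) WE EE mulmx0 oppr0 addr0 WE FE mulmxN.
  by rewrite mulmx1 subrr.
have yF : y *m W *m F^T = 0.
  rewrite /y !(mulmxDl, mulNmx) WE EF mulmx1 subrr WE FF mulmx0.
  by rewrite addr0.
have yA : y *m A = 0.
  rewrite /y !(mulmxDl, mulNmx) -!(mulmxA _ E) -!(mulmxA _ F) EA FA !mulmx0.
  by rewrite oppr0 !addr0 -scalemxAl y0A scaler0.
have xy : x *m W *m y^T = 1%:M.
  have -> : y^T = y1^T - E^T *m (y1 *m W *m F^T)^T + F^T *m (y1 *m W *m E^T)^T.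
    by rewrite -!trmx_mul -linearB -linearD.
  by rewrite !mulmxDr mulmxN xy1 !mulmxA xE xF !mul0mx subr0 addr0.
have Ey : E *m W *m y^T = 0 by rewrite form_antisym yE trmx0 oppr0.
have Fy : F *m W *m y^T = 0 by rewrite form_antisym yF trmx0 oppr0.
rewrite -addn1; exists (col_mx E x), (col_mx F y).
rewrite !mul_col_mx !tr_col_mx !mul_mx_row.
rewrite -![col_mx (row_mx _ _) _]/(block_mx _ _ _ _) EA FA xA yA !col_mx0; split=> //.
- by rewrite EE Ex xE form_alternating block_mx0.
- by rewrite FF Fy yF form_alternating block_mx0.
- by rewrite EF Ey xF xy -scalar_mx_block.
Qed.

End SymplecticBasis.

(** * Nondegeneracy of dt /\ a + w and non-vanishing of a /\ w^j *)

Section AltSumNondegenerate.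
Variables (R : realFieldType) (j m : nat).
Hypothesis mE : m = (1 + (j + j))%N.
Variables (A : 'cV[R]_m) (W : 'M[R]_m).
Hypothesis WT : W^T = - W.

Let a (x : 'rV[R]_m) : R := (x *m A) 0 0.
Let w (x y : 'rV[R]_m) : R := (x *m W *m y^T) 0 0.

(* The form dt /\ a + w on R x V is nondegenerate. *)
Definition ext_nondeg := forall (u0 : R) (u : 'rV[R]_m), (u0 != 0) || (u != 0) ->
  exists v0 v, u0 * a v - v0 * a u + w u v != 0.

Lemma ext_nondeg_alt_sum : ext_nondeg -> exists v, @alt_sum R j _ a w v != 0.
Proof.
move=> nd.
have scal1 (x : 'M[R]_1) : x 0 0 = 0 -> x = 0.
  by move=> x0; apply/matrixP => k l; rewrite !ord1 x0 mxE.
have wC x y : w x y = - w y x.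
  by rewrite /w form_antisym// 2!mxE.
have wZl c x y : w (c *: x) y = c * w x y.
  by rewrite /w -!scalemxAl mxE.
have w0 x : w 0 x = 0 by rewrite /w !mul0mx mxE.
have subZ (X Y : 'M[R]_1) c : (X - c *: Y) 0 0 = X 0 0 - c * Y 0 0.
  by rewrite !mxE.
(* Nondegeneracy tested on d/dt alone shows that a is nonzero. *)
have [z az] : exists z, a z = 1.
  have [|v0 [v]] := nd 1 0; first by rewrite oner_neq0.
  rewrite w0 mul1r {2}/a mul0mx mxE mulr0 subr0 addr0 => av.
  by exists ((a v)^-1 *: v); rewrite /a -scalemxAl mxE mulVf.
(* Test nondegeneracy on (- w(x, z), x): since a(x) = 0, the value on (v0, v) is w(x, v - a(v) z),
   and v - a(v) z lies in ker a. *)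
have nd' (x : 'rV_m) : x != 0 -> x *m A = 0 ->
    exists2 y : 'rV_m, y *m A = 0 & x *m W *m y^T != 0.
  move=> x0 xA; have ax : a x = 0 by rewrite /a xA mxE.
  have [|v0 [v]] := nd (- w x z) x; first by rewrite x0 orbT.
  rewrite ax mulr0 subr0 => H; exists (v - a v *: z).
    by apply: scal1; rewrite mulmxBl -scalemxAl subZ -/(a v) -/(a z) az mulr1 subrr.
  apply: contraNneq H => H.
  have : (x *m W *m (v - a v *: z)^T) 0 0 = 0 by rewrite H mxE.
  rewrite linearB linearZ /= mulmxBr -scalemxAr subZ -/(w x v) -/(w x z).
  by rewrite mulNr [w x z * _]mulrC addrC => ->.
have [E [F [EA FA EE FF EF]]] := symplectic_basis mE WT nd' (leqnn j).
exists (lrcase z (fun i => row i E) (fun i => row i F)).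
have wrow (k l : nat) (X : 'M[R]_(k, m)) (Y : 'M[R]_(l, m)) p q :
    w (row p X) (row q Y) = (X *m W *m Y^T) p q.
  by rewrite /w tr_row colE mulmxA -!row_mul -colE mxE [LHS]mxE.
have arow k (X : 'M[R]_(k, m)) p : X *m A = 0 -> a (row p X) = 0.
  by move=> XA; rewrite /a -row_mul XA row0 mxE.
apply: lt0r_neq0; apply: alt_sum_gt0 => *; rewrite ?lrcase0 ?lrcasel ?lrcaser//.
- exact: arow.
- exact: arow.
- by rewrite wrow EE mxE.
- by rewrite wrow FF mxE.
- by rewrite wrow EF mxE.
- by rewrite wC wrow EF mxE eq_sym.
Qed.

Lemma alt_sum_ext_nondeg : (exists v, @alt_sum R j _ a w v != 0) -> ext_nondeg.
Proof.
case=> v Sv u0 u unz; apply: contrapT => nex.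
have H v0 x : u0 * a x - v0 * a u + w u x = 0.
  by apply/eqP; apply: contrapT => /negP ?; apply: nex; exists v0, x.
(* Pairing the kernel vector (u0, u) with d/dt gives a(u) = 0; pairing it with (0, x) gives w(u, x)
   = - u0 a(x). *)
have au : a u = 0.
  by have := H 1 0; rewrite /a /w trmx0 mulmx0 mul0mx !mxE; lra.
have wu x : w u x = - u0 * a x by have := H 0 x; rewrite au; lra.
have wu' x : w x u = - (- u0 * a x).
  by rewrite -wu /w [in LHS]form_antisym// 2!mxE.
have [uE|un0] := eqVneq u 0.
  have a0 x : a x = 0.
    have /eqP := wu x; rewrite uE /w !mul0mx mxE eq_sym mulNr oppr_eq0 mulf_eq0.
    by move: unz; rewrite uE eqxx orbF => /negbTE -> /eqP.
  move/eqP: Sv; apply; rewrite /alt_sum big1// => s _.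
  by rewrite a0 mul0r mulr0.
(* There remains the case of a nonzero [u]. All that depends on [m] is generalized so that [mE] can
   be substituted, since the determinant needs as many coordinates as positions. *)
move: A W WT @a @w v Sv u unz nex H au wu wu' un0; rewrite mE.
move=> A' W' WT' a' w' v Sv u _ _ _ au wu wu' un0.
have [K KE] : exists K, forall v, alt_sum a' w' v = K * \det (\matrix_(i, k) v i 0 k).
  apply: (@alt_sum_det _ _ _ _ (fun p => A' p 0) (fun p q => W' p q)) => [x|x y].
    by rewrite /a' mxE.
  rewrite /w' mxE exchange_big /=; apply: eq_bigr => q _.
  by rewrite !mxE mulr_suml; apply: eq_bigr => p _; rewrite mulrAC.
have /rV0Pn[k0 uk0] := un0.
(* A basis containing [u]: the standard one, with [u] replacing a vector along which its coordinate
   is nonzero. *)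
pose b i : 'rV[R]_(1 + (j + j)) := if i == k0 then u else delta_mx 0 i.
have Sb : alt_sum a' w' b = 0.
  by apply: (@alt_sum_eq0 _ _ _ _ _ (- u0) _ k0); rewrite /b eqxx.
have : \matrix_(i, k) b i 0 k \in unitmx.
  rewrite -row_free_unit -kermx_eq0; apply/rowV0P => x /sub_kermxP xb.
  have xk k : \sum_i x 0 i * b i 0 k = 0.
    transitivity ((x *m \matrix_(i, k) b i 0 k) 0 k); last by rewrite xb mxE.
    by rewrite mxE; apply: eq_bigr => i _; rewrite mxE.
  have xk0 : x 0 k0 = 0.
    have := xk k0; rewrite (bigD1 k0)//= {1}/b eqxx big1 ?addr0 => [|i ik].
      by move=> /eqP; rewrite mulf_eq0 (negbTE uk0) orbF => /eqP.
    by rewrite /b (negbTE ik) mxE eqxx eq_sym (negbTE ik) mulr0.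
  apply/rowP => k; rewrite mxE; have [->//|kk0] := eqVneq k k0.
  have := xk k; rewrite (bigD1 k)//= {1}/b (negbTE kk0) mxE !eqxx mulr1.
  rewrite big1 ?addr0// => i ik; rewrite /b; case: eqVneq => [->|_].
    by rewrite xk0 mul0r.
  by rewrite mxE eqxx eq_sym (negbTE ik) mulr0.
(* Vanishing on a basis forces [K] = 0, against the nonzero value at [v]. *)
rewrite unitmxE unitfE => db; have := Sb; rewrite KE => /eqP.
rewrite mulf_eq0 (negbTE db) orbF => /eqP K0.
by move: Sv; rewrite KE K0 mul0r eqxx.
Qed.

End AltSumNondegenerate.

(** Reordering positions multiplies an alternation by the signature of the reordering, here [h]
    viewed as a permutation. It passes from the adjacent pairs of [wedge_pow] to the two halves of
    [alt_sum]. *)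
Lemma alternation_reindex (R : realType) (V : Type) d1 d (e : d1 = d)
    (h : 'I_d -> 'I_d1) (Phi : ('I_d -> V) -> R) : injective h ->
  exists b : bool, forall v : 'I_d1 -> V,
    \sum_(s : 'S_d1) (-1) ^+ s * Phi (fun k => v (s (h k))) =
    (-1) ^+ b * \sum_(s : 'S_d) (-1) ^+ s *
      Phi (fun k => v (cast_ord (esym e) (s k))).
Proof.
subst d1 => hI; pose psi : 'S_d := perm hI; exists (odd_perm psi) => v.
rewrite [in RHS](reindex_inj (mulgI psi)) /= mulr_sumr; apply: eq_bigr => s _.
rewrite odd_permM signr_addb -mulrA signrMK; congr (_ * Phi _).
by apply: funext => k; rewrite cast_ord_id permM permE.
Qed.

Section Linear.
Variables (R : realFieldType) (m : nat).

Lemma linear_form_rowE (f : 'rV[R]_m -> R) :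
  (forall c x y, f (c *: x + y) = c * f x + f y) ->
  forall x, f x = \sum_i x 0 i * f (delta_mx 0 i).
Proof.
move=> fl x; have f0 : f 0 = 0.
  by have := fl 1 0 0; rewrite scale1r addr0 mul1r; lra.
rewrite {1}[x]row_sum_delta (big_morph f (id1 := 0) (op1 := +%R))//.
  by apply: eq_bigr => i _; rewrite -[X in f X]addr0 fl f0 addr0.
by move=> y z; rewrite -[y]scale1r fl mul1r scale1r.
Qed.

End Linear.

Section ContactNondegenerate.
Variables (R : realType) (m : nat) (M : charted R m) (a : kfield M 1)
  (w : kfield M 2) (p : M) (j : nat).
Hypothesis mE : m = (1 + j * 2)%N.
Local Notation V := 'rV[R]_m.
Let a1 (x : V) := a p (fun _ => x).
Let w2 (x y : V) := w p (tnth [tuple x; y]).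
Hypotheses (alin : forall c x y, a1 (c *: x + y) = c * a1 x + a1 y)
  (wlinr : forall z c x y, w2 z (c *: x + y) = c * w2 z x + w2 z y)
  (wanti : forall x y, w2 x y = - w2 y x).

Lemma wedge_1_pow_alt_sum :
  (exists v, wedge a (wedge_pow w j) p v != 0) <->
  (exists v, @alt_sum R j _ a1 w2 v != 0).
Proof.
have [c c0 E] := wedge_1_powE a w j.
have dE : (1 + j * 2 = 1 + (j + j))%N by rewrite muln2 addnn.
pose h : 'I_(1 + (j + j)) -> 'I_(1 + j * 2) := lrcase (lshift _ ord0)
  (fun i => rshift 1 (pair_idx i 0)) (fun i => rshift 1 (pair_idx i 1)).
have hI : injective h.
  move=> k l; elim/lridx_ind: k => [|k|k]; elim/lridx_ind: l => [|l|l];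
  rewrite /h ?lrcase0 ?lrcasel ?lrcaser => // /eqP;
  rewrite ?eq_lrshift ?eq_rlshift ?eq_rshift // => /eqP/pair_idx_inj[] -> //.
pose Phi (u : 'I_(1 + (j + j)) -> V) :=
  a1 (u ord0) * \prod_(i < j) w2 (u (lidx i)) (u (ridx i)).
have [b Eb] := alternation_reindex dE Phi hI.
have {}E v : wedge a (wedge_pow w j) p v = c * (-1) ^+ b *
    alt_sum a1 w2 (fun k => v (cast_ord (esym dE) k)).
  rewrite E -mulrA -Eb; congr (_ * _); apply: eq_bigr => s _; congr (_ * _).
  rewrite /Phi /h lrcase0; congr (_ * _).
    by rewrite /a1; congr (a p _); apply: funext => i; rewrite ord1.
  apply: eq_bigr => i _; rewrite lrcasel lrcaser; congr (w p _).
  apply: funext => -[[|[|//]] i2]; rewrite (tnth_nth 0) /=;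
  by congr (v (s (rshift 1 (pair_idx _ _)))); apply: val_inj.
split=> [[v]|[v Sv]].
  by rewrite E mulf_eq0 negb_or => /andP[_ Sv]; eexists; exact: Sv.
exists (fun k => v (cast_ord dE k)); rewrite E !mulf_neq0 ?signr_eq0//.
by under eq_fun do rewrite cast_ordKV.
Qed.

Lemma contact_nondegenerate :
  (exists v, wedge a (wedge_pow w j) p v != 0) <->
  (forall (u0 : R) (u : V), (u0 != 0) || (u != 0) ->
    exists v0 v, u0 * a1 v - v0 * a1 u + w2 u v != 0).
Proof.
have mE' : m = (1 + (j + j))%N by rewrite mE muln2 addnn.
pose A : 'cV[R]_m := \col_i a1 (delta_mx 0 i).
pose W : 'M[R]_m := \matrix_(i, k) w2 (delta_mx 0 i) (delta_mx 0 k).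
have WT : W^T = - W by apply/matrixP => i k; rewrite !mxE wanti.
have aE : a1 = fun x => (x *m A) 0 0.
  apply: funext => x; rewrite (linear_form_rowE alin) mxE.
  by apply: eq_bigr => i _; rewrite mxE.
have wlinl z c x y : w2 (c *: x + y) z = c * w2 x z + w2 y z.
  by rewrite wanti wlinr opprD -mulrN -!wanti.
have wE : w2 = fun x y => (x *m W *m y^T) 0 0.
  apply: funext => x; apply: funext => y.
  rewrite (linear_form_rowE (wlinr x)) mxE; apply: eq_bigr => k _.
  rewrite (linear_form_rowE (wlinl _)) !mxE mulrC; congr (_ * _).
  by apply: eq_bigr => i _; rewrite mxE.
rewrite wedge_1_pow_alt_sum aE wE; split=> [nz u0 u unz|nd].
  exact: (alt_sum_ext_nondeg mE' WT nz).
exact: ext_nondeg_alt_sum.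
Qed.

End ContactNondegenerate.

(** * Calculus on normed spaces *)

Section Germs.
Variables (R : realType) (V W : normedModType R).
Implicit Types f g : V -> W.

(** Coordinate expressions are meaningful only on open chart images, so they can be compared only as
    germs. *)
Lemma near_eq_differentiable f g a : (\near a, f a = g a) ->
  differentiable f a -> differentiable g a /\ 'd g a = 'd f a :> (V -> W).
Proof.
move=> fg df; have fga := nbhs_singleton fg.
have E : g \o shift a = cst (g a) + 'd f a +o_ 0 id.
  apply/eqaddoP => e e0.
  have /eqaddoP/(_ _ e0) := diff_locally df.
  move: fg; rewrite (near_shift 0 a) subr0 => fg H.
  near=> h; have -> : (g \o shift a - (cst (g a) + 'd f a)) h =
      (f \o shift a - (cst (f a) + 'd f a)) h.
    have /= E : (fun a => f a = g a) (h + a) by near: h.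
    by rewrite !fctE /= E fga.
  by near: h.
have E2 : 'd g a = 'd f a :> (V -> W) by apply: diff_unique E => //; exact: diff_continuous.
split=> //; apply/diff_locallyP; rewrite E2; split=> //; exact: diff_continuous.
Unshelve. all: by end_near. Qed.

End Germs.

Section Smooth.
Variables (R : realType).
Implicit Types V W X : normedModType R.

Lemma open_near V (U : set V) (P : V -> Prop) x : open U -> U x ->
  (forall y, U y -> P y) -> \forall y \near x, P y.
Proof. by move=> oU Ux UP; apply: filterS UP _; exact: open_nbhs_nbhs. Qed.

Lemma C_on_ext V W k (U : set V) (f g : V -> W) : open U ->
  (forall x, U x -> f x = g x) -> C_on k U f -> C_on k U g.
Proof.
move=> oU; elim: k f g => [|k IH] f g fg /=.
  move=> fc x Ux; have fx : f y @[y --> x] --> f x := fc x Ux.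
  suff : g y @[y --> x] --> g x by [].
  by rewrite -(fg _ Ux); apply: cvg_trans fx; apply: near_eq_cvg; exact: (open_near oU Ux).
move=> [fd fC]; have D x : U x -> differentiable g x /\ 'd g x = 'd f x :> (V -> W).
  by move=> Ux; apply: near_eq_differentiable (fd _ Ux); exact: (open_near oU Ux).
split=> [x /D[]//|v]; apply: IH (fC v) => x Ux.
by have [_ ->] := D x Ux.
Qed.

Lemma smooth_on_ext V W (U : set V) (f g : V -> W) : open U ->
  (forall x, U x -> f x = g x) -> smooth_on U f -> smooth_on U g.
Proof. by move=> oU fg fs k; exact: C_on_ext (fs k). Qed.

Lemma smooth_on_differentiable V W (U : set V) (f : V -> W) x :
  smooth_on U f -> U x -> differentiable f x.
Proof. by move=> /(_ 1) [fd _] /fd. Qed.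

Lemma smooth_on_diff V W (U : set V) (f : V -> W) v :
  smooth_on U f -> smooth_on U (fun x => 'd f x v).
Proof. by move=> fs k; have [_ H] := fs k.+1; exact: H. Qed.

Lemma smooth_on_sub V W (U U' : set V) (f : V -> W) : U' `<=` U ->
  smooth_on U f -> smooth_on U' f.
Proof.
move=> UU fs k; have {fs} := fs k; elim: k f => [|k IH] f /=.
  by move=> H x /UU; exact: H.
by move=> [fd fC]; split=> [x /UU|v]; [exact: fd|exact: IH].
Qed.

Lemma smooth_on_cst V W (U : set V) (c : W) : smooth_on U (fun=> c).
Proof.
move=> k; elim: k c => [|k IH] c /=; first by move=> x _; exact: cvg_cst.
split=> [x _|v]; first exact: differentiable_cst.
rewrite (_ : (fun x => _) = fun=> 0) ?IH//.
by apply: funext => x; rewrite diff_cst.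
Qed.

Lemma smooth_onD V W (U : set V) (f g : V -> W) : open U ->
  smooth_on U f -> smooth_on U g -> smooth_on U (fun x => f x + g x).
Proof.
move=> oU fs gs k; have {fs} := fs k; have {gs} := gs k.
elim: k f g => [|k IH] f g /=.
  by move=> gc fc x Ux; apply: cvgD; [exact: fc|exact: gc].
move=> [gd gC] [fd fC]; split=> [x Ux|v].
  by apply: differentiableD; [exact: fd|exact: gd].
apply: C_on_ext (IH _ _ (gC v) (fC v)) => // x Ux.
by rewrite diffD//=; [exact: fd|exact: gd].
Qed.

Lemma smooth_onZ V W (U : set V) (f : V -> W) (c : R) : open U ->
  smooth_on U f -> smooth_on U (fun x => c *: f x).
Proof.
move=> oU fs k; have {fs} := fs k; elim: k f => [|k IH] f /=.
  by move=> fc x Ux; apply: cvgZl_tmp; exact: fc.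
move=> [fd fC]; split=> [x Ux|v].
  by apply: differentiableZ; exact: fd.
apply: C_on_ext (IH _ (fC v)) => // x Ux.
by rewrite diffZ//=; exact: fd.
Qed.

Lemma diff_affine V W X (f : W -> X) (c : W) (L : {linear V -> W}) x :
  continuous L -> differentiable f (c + L x) ->
  differentiable (fun y => f (c + L y)) x /\
  'd (fun y => f (c + L y)) x = 'd f (c + L x) \o L :> (V -> X).
Proof.
move=> cL df; pose h : V -> W := cst c + (L : V -> W).
have dL : differentiable L x 
    by exact: linear_differentiable.
have dh : differentiable h x by apply: differentiableD.
split; first exact: (differentiable_comp dh df).
rewrite -[fun y => _]/(f \o h) diff_comp//.
by rewrite diffD// diff_cst (diff_lin _ cL); apply: funext => v; rewrite /= add0r.
Qed.

(** The derivative of the composite along [v] is again such a composite, of the derivative of [f]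
    along [L v]; hence the induction on the order closes without a higher chain rule. It serves for
    the projection to the coordinates of M and for the inclusion of a slice of constant t. *)
Lemma smooth_on_affine V W X (U : set W) (f : W -> X) (c : W) (L : {linear V -> W}) :
  open U -> continuous L -> smooth_on U f ->
  smooth_on [set x | U (c + L x)] (fun x => f (c + L x)).
Proof.
move=> oU cL fs k; have {fs} := fs k.
have hc : continuous (fun x => c + L x).
  by move=> x; apply: cvgD; [exact: cvg_cst|exact: cL].
have oU' : open [set x | U (c + L x)].
  by apply: (@open_comp _ _ (fun x => c + L x)) => // x _; exact: hc.
elim: k f => [|k IH] f /=.
  move=> fc x Ux; apply: (@continuous_comp _ _ _ (fun x => c + L x)).
    exact: hc.
  exact: fc.
move=> [fd fC]; split=> [x Ux|v]; first by have [] := diff_affine cL (fd _ Ux).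
apply: C_on_ext (IH _ (fC (L v))) => // x Ux.
by have [_ ->] := diff_affine cL (fd _ Ux).
Qed.

Lemma diff_linear_comp V W X (f : V -> W) (L : {linear W -> X}) x :
  continuous L -> differentiable f x ->
  differentiable (L \o f) x /\ 'd (L \o f) x = L \o 'd f x :> (V -> X).
Proof.
move=> cL df; have dL : differentiable L (f x) 
    by exact: linear_differentiable.
by split; [exact: differentiable_comp|rewrite diff_comp// diff_lin].
Qed.

End Smooth.

(** * Symmetry of second derivatives *)

Section SecondDerivative.
Variables (R : realType) (V : normedModType R).
Implicit Types (f : V -> R).

Lemma mean_value_segment f p u (t : R) : 0 < t ->
  (forall s, 0 <= s <= t -> differentiable f (p + s *: u)) ->
  exists2 c, 0 <= c <= t & f (p + t *: u) - f p = t * 'd f (p + c *: u) u.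
Proof.
move=> t0 fd; pose g (s : R) : V := p + s *: u.
have gd (s : R) : differentiable g s /\ 'd g s = (fun h : R => h *: u) :> (R -> V).
  have dc : differentiable (cst p : R -> V) s by exact: differentiable_cst.
  have [ds ds'] : is_diff s ( *:%R ^~ u : R -> V) ( *:%R ^~ u) by exact: is_diff_scalel.
  have gE : g = cst p + ( *:%R ^~ u) by [].
  rewrite gE; split; first exact: (differentiableD dc ds).
  by rewrite (diffD dc ds) diff_cst ds'; apply: funext => h /=; rewrite add0r.
have fgd s : 0 <= s <= t -> differentiable (f \o g) s.
  by move=> st; apply: differentiable_comp; [by have [] := gd s|exact: fd].
have fgD s : 0 <= s <= t -> is_derive s 1 (f \o g) ('d f (g s) u).
  move=> st; apply: DeriveDef; first exact/diff_derivable/fgd.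
  rewrite deriveE; last exact: fgd.
  have [d1 d2] := gd s; rewrite diff_comp//=; last exact: fd.
  by rewrite d2 scale1r.
have [||c] := @MVT R (f \o g) (fun s => 'd f (g s) u) 0 t t0.
- by move=> s; rewrite in_itv /= => /andP[s0 st]; apply: fgD; rewrite !ltW.
- apply: derivable_within_continuous => s; rewrite in_itv /= => st.
  exact/diff_derivable/fgd.
rewrite in_itv /= => /andP[c0 ct] E; exists c; first by rewrite !ltW.
by move: E; rewrite /g /= scale0r addr0 subr0 mulrC.
Qed.

(** The mean value theorem twice: along [u] for the increment [F] of [f] by [t *: v], then along [v]
    for the derivative of [f] in direction [u]. *)
Lemma second_difference f x u v (t : R) : 0 < t ->
  (forall r s, 0 <= r <= t -> 0 <= s <= t ->
    differentiable f (x + r *: u + s *: v) /\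
    differentiable (fun y => 'd f y u) (x + r *: u + s *: v)) ->
  exists r s, [/\ 0 <= r <= t, 0 <= s <= t &
    f (x + t *: u + t *: v) - f (x + t *: u) - (f (x + t *: v) - f x) =
    t ^+ 2 * 'd (fun y => 'd f y u) (x + r *: u + s *: v) v].
Proof.
move=> t0 fd; pose F y := f (t *: v + y) - f y.
have tt : 0 <= t <= t by apply/andP; split; [exact: ltW|exact: lexx].
have t00 : 0 <= (0 : R) <= t by apply/andP; split; [exact: lexx|exact: ltW].
have Fd r : 0 <= r <= t -> differentiable F (x + r *: u) /\
    'd F (x + r *: u) u = 'd f (x + r *: u + t *: v) u - 'd f (x + r *: u) u.
  move=> rt; have [d1 _] := fd r t rt tt; have [d0 _] := fd r 0 rt t00.
  rewrite scale0r addr0 in d0.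
  rewrite [_ + t *: v]addrC in d1.
  have cid : continuous (idfun : V -> V) by move=> y; exact: cvg_id.
  have [s1 s2] := diff_affine (L := idfun) cid d1.
  split; first exact: (differentiableB s1 d0).
  have /(congr1 (fun h => h u)) -> := diffB s1 d0.
  rewrite [X in _ = 'd f X u - _]addrC.
  exact: (congr1 (fun h : V -> R => h u - 'd f (x + r *: u) u) s2).
have [|r rt Er] := @mean_value_segment F x u t t0; first by move=> s /Fd[].
have [|s st Es] := @mean_value_segment (fun y => 'd f y u) (x + r *: u) v t t0.
  by move=> s st; have [] := fd r s rt st.
exists r, s; split=> //.
have [_ E2] := Fd r rt.
rewrite [x + _ + _]addrC [x + t *: v]addrC -/(F (x + t *: u)) -/(F x) Er E2 Es.
by rewrite expr2 mulrA.
Qed.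

(* Schwarz's theorem: both sides are close to the same second difference
   quotient. *)
Lemma second_derivative_sym (U : set V) f x u v : open U -> U x -> C_on 2 U f ->
  'd (fun y => 'd f y v) x u = 'd (fun y => 'd f y u) x v.
Proof.
move=> oU Ux [fd fC].
have fdd w y : U y -> differentiable (fun y => 'd f y w) y.
  by have [H _] := fC w; exact: H.
have fcc w z : {for x, continuous (fun y => 'd (fun y => 'd f y w) y z)}.
  by have [_ /(_ z) H] := fC w; exact: H.
apply/eqP; rewrite -subr_eq0 -normr_le0; apply/ler_addgt0Pl => e e0.
rewrite addr0.
have e20 : 0 < e / 2 by rewrite divr_gt0.
have : \forall y \near x, [/\ U y,
    `|'d (fun y => 'd f y v) x u - 'd (fun y => 'd f y v) y u| < e / 2 &
    `|'d (fun y => 'd f y u) x v - 'd (fun y => 'd f y u) y v| < e / 2].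
  near=> y; split.
  - by near: y; exact: open_nbhs_nbhs.
  - by near: y; have /cvgrPdist_lt := fcc v u; exact.
  - by near: y; have /cvgrPdist_lt := fcc u v; exact.
move=> /nbhs_ballP[d /= d0 H].
(* Keeps the parallelogram with sides [t *: u] and [t *: v] within distance d / 2 of [x]; the
   summand 1 keeps the denominator positive when [u] and [v] vanish. *)
pose t := d / 2 / (`|u| + `|v| + 1).
have uv0 : 0 < `|u| + `|v| + 1 by rewrite ltr_wpDl// addr_ge0.
have t0 : 0 < t by rewrite !divr_gt0.
have inb w1 w2 r s : `|w1| + `|w2| = `|u| + `|v| -> 0 <= r <= t -> 0 <= s <= t ->
    ball x d (x + r *: w1 + s *: w2).
  move=> ww /andP[r0 rt] /andP[s0 st]; rewrite -ball_normE /ball_ /=.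
  rewrite -addrA opprD addNKr normrN (le_lt_trans (ler_normD _ _))//.
  rewrite !normrZ !ger0_norm//.
  apply: (@le_lt_trans _ _ (t * (`|u| + `|v| + 1))).
    rewrite -ww !mulrDr mulr1; apply: ler_wpDr; first exact: ltW.
    by apply: lerD; apply: ler_wpM2r.
  by rewrite /t divfK ?gt_eqF// ltr_pdivrMr// mulr_natr mulr2n ltrDl.
have [|r [s [rt st E1]]] := @second_difference f x u v t t0.
  move=> r s rt st; have [Uy _ _] := H _ (inb u v r s erefl rt st).
  by split; [exact: fd|exact: fdd].
have [|r' [s' [rt' st' E2]]] := @second_difference f x v u t t0.
  move=> r' s' rt' st'; have [Uy _ _] := H _ (inb v u r' s' (addrC _ _) rt' st').
  by split; [exact: fd|exact: fdd].
have [_ _ H1] := H _ (inb u v r s erefl rt st).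
have [_ H2 _] := H _ (inb v u r' s' (addrC _ _) rt' st').
(* The second difference is symmetric in [u] and [v], so its two expressions agree after division by
   t^2. *)
have E : 'd (fun y => 'd f y u) (x + r *: u + s *: v) v =
    'd (fun y => 'd f y v) (x + r' *: v + s' *: u) u.
  apply: (@mulfI _ (t ^+ 2)); first by rewrite expf_neq0// gt_eqF.
  by rewrite -E1 -E2 (addrAC x (t *: v)); ring.
rewrite -[X in `|X|](subrKA ('d (fun y => 'd f y v) (x + r' *: v + s' *: u) u)).
rewrite (le_trans (ler_normD _ _))// (splitr e) ltW// ltrD//.
by rewrite distrC -E.
Unshelve. all: by end_near. Qed.

End SecondDerivative.

Section RowVectorCalculus.
Variables (R : realType).
Implicit Types V W : normedModType R.

Lemma linear_rV_continuous W n (L : {linear 'rV[R]_n -> W}) : continuous L.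
Proof.
have -> : (L : 'rV[R]_n -> W) =
    \sum_(i < n) (fun x : 'rV[R]_n => x 0 i *: L (delta_mx 0 i)).
  apply: funext => x; rewrite fct_sumE {1}[x]row_sum_delta linear_sum.
  by apply: eq_bigr => i _; rewrite linearZ.
move=> x; apply: (big_ind (fun f : 'rV[R]_n -> W => {for x, continuous f})).
- exact: (@cst_continuous _ _ (0 : W)).
- by move=> f g fc gc; exact: (continuousD fc gc).
- move=> i _; apply: (@cvgZr_tmp _ _ _ (nbhs x) _ (fun y : 'rV_n => y 0 i) (x 0 i)).
  exact: coord_continuous.
Qed.

Lemma diff_coord V n (f : V -> 'rV[R]_n) x k : differentiable f x ->
  differentiable (fun y => f y 0 k) x /\
  forall v, 'd (fun y => f y 0 k) x v = 'd f x v 0 k.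
Proof.
move=> df; have dk : differentiable (fun y => f y 0 k) x.
  exact: (differentiable_comp df (differentiable_coord _ _ _)).
split=> // v; rewrite -(deriveE _ dk) -(deriveE _ df) derive_mx ?mxE//.
exact: diff_derivable.
Qed.

Lemma C_on_coord V n k (U : set V) (f : V -> 'rV[R]_n) i : open U ->
  C_on k U f -> C_on k U (fun x => f x 0 i).
Proof.
move=> oU; elim: k f => [|k IH] f /=.
  move=> fc x Ux; apply: (@continuous_comp _ _ _ f (fun M : 'rV[R]_n => M 0 i)).
    exact: fc.
  exact: coord_continuous.
move=> [fd fC]; split=> [x Ux|v]; first by have [] := diff_coord i (fd _ Ux).
apply: C_on_ext (IH _ (fC v)) => // x Ux.
by have [_ ->] := diff_coord i (fd _ Ux).
Qed.

Lemma second_derivative_sym_rV V n (U : set V) (f : V -> 'rV[R]_n) x u v :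
  open U -> U x -> C_on 2 U f ->
  'd (fun y => 'd f y v) x u = 'd (fun y => 'd f y u) x v.
Proof.
move=> oU Ux fC2; have [fd fC] := fC2.
have fdd w : differentiable (fun y => 'd f y w) x by have [H _] := fC w; exact: H.
have E w z k : ('d (fun y => 'd f y w) x z) 0 k =
    'd (fun y => 'd (fun y => f y 0 k) y w) x z.
  have [d1 <-] := diff_coord k (fdd w).
  have near_eq : \near x, 'd f x w 0 k = 'd (fun y => f y 0 k) x w.
    by apply: (open_near oU Ux) => y Uy; have [_ ->] := diff_coord k (fd _ Uy).
  have [_ H] := near_eq_differentiable near_eq d1.
  exact: (congr1 (fun h : V -> R => h z) (esym H)).
apply/rowP => k; rewrite !E.
by exact: (@second_derivative_sym R V U (fun y => f y 0 k) x u v oU Ux (C_on_coord k oU fC2)).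
Qed.

Lemma diff_lincomb V n (c : 'I_n -> R) (g : 'I_n -> V -> R) x :
  (forall k, differentiable (g k) x) ->
  differentiable (fun z => \sum_(k < n) c k * g k z) x /\
  forall u, 'd (fun z => \sum_(k < n) c k * g k z) x u =
    \sum_(k < n) c k * 'd (g k) x u.
Proof.
move=> gd; have E : (fun z => \sum_(k < n) c k * g k z) = \sum_(k < n) (c k *: g k).
  by apply: funext => z; rewrite fct_sumE.
have dg k : differentiable (c k *: g k) x by exact: differentiableZ.
have dS : differentiable (fun z => \sum_(k < n) c k * g k z) x.
  by rewrite E; exact: differentiable_sum.
split=> // u; rewrite -(deriveE _ dS) E derive_sum => [|k].
  apply: eq_bigr => k _; rewrite deriveZ; last exact: diff_derivable.
  by rewrite (deriveE _ (gd k)).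
exact: diff_derivable.
Qed.

(** Linearity of [B] in its second argument reduces this to the product rule for the coordinates of
    [psi]. It differentiates the coefficients of a 1-form after a change of chart: [phi] is the
    transition map, [psi] its derivative along a fixed vector. *)
Lemma diff_pairing V n (phi psi : V -> 'rV[R]_n) (B : 'rV[R]_n -> 'rV[R]_n -> R) x :
  (forall z c e e', B z (c *: e + e') = c * B z e + B z e') ->
  differentiable phi x -> differentiable psi x ->
  (forall e, differentiable (B ^~ e) (phi x)) ->
  differentiable (fun y => B (phi y) (psi y)) x /\
  forall u, 'd (fun y => B (phi y) (psi y)) x u =
    B (phi x) ('d psi x u) + 'd (B ^~ (psi x)) (phi x) ('d phi x u).
Proof.
move=> Bl dphi dpsi dB.
pose e k : 'rV[R]_n := delta_mx 0 k.
pose p k y := psi y 0 k.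
pose b k := (B ^~ (e k)) \o phi.
have dp k : differentiable (p k) x by have [] := diff_coord k dpsi.
have db k : differentiable (b k) x by exact: (differentiable_comp dphi (dB (e k))).
have dpb k : differentiable (p k * b k) x by exact: differentiableM.
have FE : (fun y => B (phi y) (psi y)) = \sum_(k < n) (p k * b k).
  by apply: funext => y; rewrite (linear_form_rowE (Bl _)) fct_sumE.
have dF : differentiable (fun y => B (phi y) (psi y)) x.
  by rewrite FE; exact: differentiable_sum.
split=> // u; rewrite -(deriveE _ dF) FE derive_sum => [|k]; last exact: diff_derivable.
have BE : B^~ (psi x) = fun z => \sum_(k < n) p k x * B z (e k).
  by apply: funext => z; rewrite (linear_form_rowE (Bl _)).
have [_ DE] := diff_lincomb (p ^~ x) (fun k => dB (e k)).
rewrite BE DE (linear_form_rowE (Bl (phi x))) -big_split /=; apply: eq_bigr => k _.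
have [_ pE] := diff_coord k dpsi.
have pE' : 'D_u (p k) x = 'd psi x u 0 k by rewrite (deriveE _ (dp k)) pE.
have bE' : 'D_u (b k) x = 'd (B ^~ (e k)) (phi x) ('d phi x u).
  apply: etrans (deriveE _ (db k)) _.
  exact: (congr1 (fun h : V -> R => h u) (diff_comp dphi (dB (e k)))).
apply: etrans (deriveM (diff_derivable (dp k)) (diff_derivable (db k))) _.
by rewrite pE' bE' [LHS]addrC [X in X + _]mulrC.
Qed.

End RowVectorCalculus.

(** * Charts of the circle, of M and of their product *)

Section CircleChart.
Variable R : realType.
Local Notation pi := (@pi R).

Lemma of_circleK (q : circle_type R) : to_circle (of_circle q) = q.
Proof. by rewrite /to_circle /of_circle reprK. Qed.

Lemma to_circleP (s t : R) :
  to_circle s = to_circle t <-> exists k : int, s = t + 2 * pi * k%:~R.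
Proof.
have p0 : 2 * pi != 0 by rewrite mulf_neq0// gt_eqF// pi_gt0.
rewrite /to_circle; split=> [/eqmodP /intrP[k kE]|[k ->]].
  by exists k; rewrite -kE mulrC divfK// addrC subrK.
apply/eqmodP/intrP; exists k.
by rewrite addrC addKr mulrC mulKf.
Qed.

(** This makes every change of chart of the circle a translation near a point. *)
Lemma circle_lift_to_circle (r t0 t : R) :
  to_circle r = to_circle t0 -> `|t - t0| < pi ->
  circle_lift r (to_circle t) = r + (t - t0).
Proof.
move=> /to_circleP[l rE]; rewrite ltr_norml => /andP[tl tr].
have [k kE] : exists k : int, of_circle (to_circle t) = t + 2 * pi * k%:~R.
  by apply/to_circleP; rewrite of_circleK.
have p0 : 0 < 2 * pi by rewrite mulr_gt0// pi_gt0.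
(* The argument of the floor is k - l + (t - t0 + pi) / (2 pi), whose last summand lies strictly
   between 0 and 1. *)
rewrite /circle_lift; rewrite (@floor_def _ _ (k - l)).
  by rewrite kE rE intrB; ring.
rewrite ler_pdivlMr// ltr_pdivrMr// kE rE !(intrD, intrB).
by apply/andP; split; lra.
Qed.

Lemma circle_cimgE (s : circle R) (y : 'rV[R]_1) :
  cimg s y <-> `|y 0 0 - of_circle s| < pi.
Proof.
have lift t : `|t - of_circle s| < pi -> circle_lift (of_circle s) (to_circle t) = t.
  by move=> ?; rewrite (@circle_lift_to_circle _ (of_circle s))// addrC subrK.
split=> [[q [t]]|H].
  rewrite /= in_itv /= => /andP[t1 t2] <- <-; rewrite mxE.
  have H : `|t - of_circle s| < pi by rewrite ltr_norml; apply/andP; split; lra.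
  by rewrite lift.
exists (to_circle (y 0 0)).
  exists (y 0 0) => //=; rewrite in_itv /=.
  by move: H; rewrite ltr_norml => /andP[? ?]; apply/andP; split; lra.
by apply/rowP => i; rewrite !mxE !ord1 lift.
Qed.

Lemma circle_addE (s : circle R) (t : R) :
  circle_add s (to_circle t) = to_circle (of_circle s + t).
Proof.
apply/to_circleP; have /to_circleP[k ->] := of_circleK (to_circle t).
by exists k; rewrite addrA.
Qed.

End CircleChart.

Section FormsLow.
Variables (R : realType) (m : nat).
Local Notation V := 'rV[R]_m.

Lemma multilinear1 (f : ('I_1 -> V) -> R) : multilinear f <->
  forall c x y, f (fun=> c *: x + y) = c * f (fun=> x) + f (fun=> y).
Proof.
have E (v : 'I_1 -> V) z : dfwith v ord0 z = fun=> z.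
  by apply: funext => i; rewrite (ord1 i) dfwithin.
split=> [fl c x y|fl v i c x y].
  by have := fl (fun=> 0) ord0 c x y; rewrite !E.
by rewrite !ord1 !E fl.
Qed.

Lemma alternating1 (f : ('I_1 -> V) -> R) : Defs.alternating f.
Proof. by move=> v i j; rewrite !ord1. Qed.

Lemma vec1E (v : 'I_1 -> V) : v = fun=> v ord0.
Proof. by apply: funext => i; rewrite ord1. Qed.

Lemma vec2E (v : 'I_2 -> V) : v = tnth [tuple v ord0; v ord_max].
Proof.
by apply: funext => -[[|[|//]] i]; rewrite (tnth_nth 0) /=; congr v; apply: val_inj.
Qed.

Lemma ord2P (i : 'I_2) : i = ord0 \/ i = ord_max.
Proof. by case: i => [[|[|//]] i]; [left|right]; apply: val_inj. Qed.

(** Antisymmetry is equivalent to being alternating as 2 is invertible, and it transfers linearity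
    from the second argument to the first. *)
Lemma multilinear_alternating2 (f : ('I_2 -> V) -> R) :
  multilinear f /\ Defs.alternating f <->
  (forall z c x y, f (tnth [tuple z; c *: x + y]) =
    c * f (tnth [tuple z; x]) + f (tnth [tuple z; y])) /\
  (forall x y, f (tnth [tuple x; y]) = - f (tnth [tuple y; x])).
Proof.
have E0 (v : 'I_2 -> V) z : dfwith v ord0 z = tnth [tuple z; v ord_max].
  rewrite [LHS]vec2E dfwithin dfwithout//.
have E1 (v : 'I_2 -> V) z : dfwith v ord_max z = tnth [tuple v ord0; z].
  by rewrite [LHS]vec2E dfwithin dfwithout.
have T0 (x y : V) : tnth [tuple x; y] ord0 = x by [].
have T1 (x y : V) : tnth [tuple x; y] ord_max = y by [].
split=> [[fl fa]|[fl fa]].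
  have fl1 z c x y : f (tnth [tuple z; c *: x + y]) =
      c * f (tnth [tuple z; x]) + f (tnth [tuple z; y]).
    by have := fl (tnth [tuple z; z]) ord_max c x y; rewrite !E1 T0.
  have fl0 z c x y : f (tnth [tuple c *: x + y; z]) =
      c * f (tnth [tuple x; z]) + f (tnth [tuple y; z]).
    by have := fl (tnth [tuple z; z]) ord0 c x y; rewrite !E0 T1.
  have f0 x : f (tnth [tuple x; x]) = 0 by exact: (fa _ ord0 ord_max).
  split=> // x y; have := f0 (1 *: x + y).
  by rewrite fl0 !fl1 !f0 !mul1r addr0 add0r => /eqP; rewrite addr_eq0 => /eqP.
have fl0 z c x y : f (tnth [tuple c *: x + y; z]) =
    c * f (tnth [tuple x; z]) + f (tnth [tuple y; z]).
  by rewrite fa fl opprD -mulrN -!fa.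
split=> [v i c x y|v i j ij vij].
  by have [->|->] := ord2P i; rewrite ?E0 ?fl0 ?E1 ?fl.
have vE : v ord0 = v ord_max.
  by move: ij vij; have [->|->] := ord2P i; have [->|->] := ord2P j => // _ ->.
rewrite [v]vec2E vE; have := fa (v ord_max) (v ord_max); lra.
Qed.

End FormsLow.

(** * Changes of chart and the exterior derivative in a fixed chart *)

Section Charts.
Variables (R : realType) (m : nat) (M : charted R m).
Hypothesis sm : smooth_atlas M.
Implicit Types (p q r : M) (x y : 'rV[R]_m).

Lemma cimg_center p : cimg p (cmap p p).
Proof. by have [/(_ p)[]] := sm; exists p. Qed.

Lemma cimg_open p : open (cimg p).
Proof. by have [/(_ p)[]] := sm. Qed.

Lemma cinvK p q : cdom p q -> cinv p (cmap p q) = q.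
Proof. by have [_ [H _]] := sm; exact: H. Qed.

Lemma cimgP p x : cimg p x -> cdom p (cinv p x) /\ cmap p (cinv p x) = x.
Proof. by move=> [q pq <-]; rewrite cinvK. Qed.

Definition overlap p q : set 'rV[R]_m := cmap p @` (cdom p `&` cdom q).

Definition transition p q : 'rV[R]_m -> 'rV[R]_m := cmap q \o cinv p.

Lemma transition_smooth p q : smooth_on (overlap p q) (transition p q).
Proof. by have [_ [_ H]] := sm; exact: H. Qed.

Lemma overlapP p q x : overlap p q x <-> cimg p x /\ cdom q (cinv p x).
Proof.
split=> [[r [pr qr] <-]|[/cimgP[pd px] qx]].
  by split; [exists r|rewrite cinvK].
by exists (cinv p x).
Qed.

Lemma overlap_open p q : open (overlap p q).
Proof.
have [/(_ p)[_ _ oi _ cc] _] := sm.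
have [/(_ q)[_ oq _ _ _] _] := sm.
have -> : overlap p q = cimg p `&` cinv p @^-1` cdom q.
  by apply/seteqP; split=> x /overlapP.
rewrite openE => x [px qx]; apply: filterI; first exact: open_nbhs_nbhs.
have := cc; rewrite continuous_open_subspace// => /(_ x).
by rewrite inE => /(_ px); apply; exact: open_nbhs_nbhs.
Qed.

Lemma overlap_self p x : cimg p x -> overlap p (cinv p x) x.
Proof.
move=> px; apply/overlapP; split=> //.
by have [/(_ (cinv p x))[]] := sm.
Qed.

Lemma transition_differentiable p q x : overlap p q x ->
  differentiable (transition p q) x.
Proof. exact: smooth_on_differentiable (@transition_smooth p q). Qed.

Lemma transition_cocycle p q r x : overlap p q x -> overlap p r x ->
  'd (transition p r) x = 'd (transition q r) (transition p q x) \o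
    'd (transition p q) x :> ('rV[R]_m -> 'rV[R]_m).
Proof.
move=> pqx prx; have dpq := transition_differentiable pqx.
have dqr : differentiable (transition q r) (transition p q x).
  apply: transition_differentiable.
  move: pqx prx => /overlapP[px qx] /overlapP[_ rx].
  by exists (cinv p x).
rewrite -(diff_comp dpq dqr).
have E : \near x, (transition q r \o transition p q) x = transition p r x.
  apply: (open_near (@overlap_open p q) pqx) => y /overlapP[_ qy].
  by rewrite /transition /= cinvK.
have [_ H] := near_eq_differentiable E (differentiable_comp dpq dqr).
exact: H.
Qed.

Lemma in_chart_transition k (w : kfield M k) p q x v : overlap p q x ->
  in_chart w p x v =
  in_chart w q (transition p q x) (fun i => 'd (transition p q) x (v i)).
Proof.
move=> pqx; have /overlapP[px qx] := pqx.
rewrite /in_chart; have -> : cinv q (transition p q x) = cinv p x.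
  by rewrite /transition /= cinvK.
congr (w _ _); apply: funext => i.
exact: (congr1 (fun h : 'rV[R]_m -> 'rV[R]_m => h (v i))
  (transition_cocycle pqx (overlap_self px))).
Qed.

Section OneForm.
Variable a : kfield M 1.
Hypothesis af : is_form a.

Definition coef p x (e : 'rV[R]_m) : R := in_chart a p x (fun=> e).

Lemma coef_linear p x c e e' : coef p x (c *: e + e') = c * coef p x e + coef p x e'.
Proof.
rewrite /coef /in_chart linearP.
by have [/(_ (cinv p x))[/multilinear1 -> _] _] := af.
Qed.

Lemma coef_smooth p e : smooth_on (cimg p) (coef p ^~ e).
Proof. by have [_ H] := af; exact: H. Qed.

Lemma coef_differentiable p x e : cimg p x -> differentiable (coef p ^~ e) x.
Proof. exact: smooth_on_differentiable (@coef_smooth p e). Qed.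

Lemma dext1E p v : dext a p v =
  'd (coef p ^~ (v ord_max)) (cmap p p) (v ord0) -
  'd (coef p ^~ (v ord0)) (cmap p p) (v ord_max).
Proof.
have cE (k : 'I_2) : (fun x : 'rV_m => in_chart a p x (fun j => v (lift k j))) =
    coef p ^~ (v (lift k ord0)).
  by apply: funext => x; rewrite /coef; congr in_chart; rewrite [LHS]vec1E.
have l0 (k : 'I_1) : lift ord0 k = ord_max :> 'I_2.
  by apply: val_inj; rewrite ord1.
have l1 (k : 'I_1) : lift ord_max k = ord0 :> 'I_2.
  by apply: val_inj; rewrite ord1.
rewrite /dext big_ord_recl big_ord1 !cE !(l0, l1) expr0 expr1 mul1r mulN1r.
by do 2 (rewrite deriveE; last exact/coef_differentiable/cimg_center).
Qed.

(* On changing chart, the terms in the second derivative of the transition map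
   cancel by Schwarz. *)
Lemma in_chart_dext p x v : cimg p x -> in_chart (dext a) p x v =
  'd (coef p ^~ (v ord_max)) x (v ord0) - 'd (coef p ^~ (v ord0)) x (v ord_max).
Proof.
move=> px; set r := cinv p x; pose phi := transition p r.
have prx : overlap p r x by exact: overlap_self.
have phix : phi x = cmap r r by [].
have dphi : differentiable phi x by exact: transition_differentiable.
have dphi2 e : differentiable (fun y => 'd phi y e) x.
  exact: smooth_on_differentiable (smooth_on_diff e (@transition_smooth p r)) prx.
have db e : differentiable (coef r ^~ e) (phi x).
  by rewrite phix; exact/coef_differentiable/cimg_center.
(* Product rule for the transformed coefficient: a term in the second derivative of [phi], symmetric
   in [e] and [u], plus the derivative of the coefficient in the chart at [r]. *)
have D e u : 'd (coef p ^~ e) x u =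
    coef r (phi x) ('d (fun y => 'd phi y e) x u) +
    'd (coef r ^~ ('d phi x e)) (phi x) ('d phi x u).
  have [d1 <-] := diff_pairing (coef_linear r) dphi (dphi2 e) db.
  have E : \near x, coef r (phi x) ('d phi x e) = coef p x e.
    apply: (open_near (@overlap_open p r) prx) => y pry.
    by rewrite /coef (in_chart_transition _ _ pry).
  have [_ H] := near_eq_differentiable E d1.
  exact: (congr1 (fun h : 'rV[R]_m -> R => h u) H).
have S := second_derivative_sym_rV (v ord0) (v ord_max) (@overlap_open p r) prx
  (@transition_smooth p r 2).
have cancel (s t c c' : R) : c = c' -> s - t = (c + s) - (c' + t).
  by move=> ->; ring.
apply: etrans (esym (congr2 (fun s t : R => s - t) (D _ _) (D _ _))).
apply: etrans (dext1E r (fun i => 'd phi x (v i))) _.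
by apply: cancel; exact: (congr1 (coef r (phi x)) S).
Qed.

End OneForm.

End Charts.

(** * Product charts: transitions, projections and the circle action *)

Section ProductChart.
Variables (R : realType) (m : nat) (M : charted R m).
Hypothesis sm : smooth_atlas M.
Local Notation N := (S1xM M).
Local Notation pi := (@pi R).
Local Notation W := 'rV[R]_(1 + m).
Implicit Types (p : N) (x y v : W).

Definition tcoord v : R := lsubmx v 0 0.

Lemma tcoord_linear c x y : tcoord (c *: x + y) = c * tcoord x + tcoord y.
Proof. by rewrite /tcoord linearP !mxE. Qed.

Lemma S1xM_cimgP p x : cimg p x <->
  `|tcoord x - of_circle p.1| < pi /\ cimg p.2 (rsubmx x).
Proof.
split=> [[q [q1 q2] <-]|[/circle_cimgE[q1 q1p E1] [q2 q2p E2]]].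
  rewrite /tcoord row_mxKl row_mxKr; split; last by exists q.2.
  by apply/circle_cimgE; exists q.1.
exists (q1, q2) => //; transitivity (row_mx (cmap p.1 q1) (cmap p.2 q2)) => //.
by rewrite E1 E2 hsubmxK.
Qed.

Lemma tcoord_continuous : continuous tcoord.
Proof.
rewrite (_ : tcoord = fun v => v 0 (lshift m 0)); last first.
  by apply: funext => v; rewrite /tcoord mxE.
exact: coord_continuous.
Qed.

Lemma S1xM_cimg_open p : open (cimg p).
Proof.
have -> : cimg p = tcoord @^-1` [set` `]of_circle p.1 - pi, of_circle p.1 + pi[] `&`
    rsubmx @^-1` (cimg p.2).
  have E x : (`|tcoord x - of_circle p.1| < pi) =
      (tcoord x \in `]of_circle p.1 - pi, of_circle p.1 + pi[).
    rewrite in_itv /= ltr_norml; apply/idP/idP => /andP[? ?]; apply/andP; split; lra.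
  apply/seteqP; split=> x.
    by move=> /S1xM_cimgP[]; rewrite E.
  by move=> [/= ? ?]; apply/S1xM_cimgP; rewrite E.
apply: openI; apply: open_comp => [x _|].
- exact: tcoord_continuous.
- exact: interval_open.
- exact: continuous_rsubmx.
- exact: cimg_open.
Qed.

Lemma S1xM_cimg_center p : cimg p (cmap p p).
Proof.
apply/S1xM_cimgP; rewrite /tcoord /= row_mxKl row_mxKr mxE.
have pi0 : 0 < pi by exact: pi_gt0.
rewrite -{2}(of_circleK p.1) (@circle_lift_to_circle _ _ (of_circle p.1))// ?subrr ?normr0//.
by rewrite addr0 subrr normr0; split=> //; exact: cimg_center.
Qed.

(** Near a point, changes of product charts and the circle action, read in charts, are a translation
    of t next to a map of the coordinates of M. The hypothesis is only local because [circle_lift]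
    jumps by 2 pi. *)
Lemma diff_block (G : W -> W) (c : 'rV[R]_1) (phi : 'rV[R]_m -> 'rV[R]_m) x :
  (\forall y \near x, row_mx (c + lsubmx y) (phi (rsubmx y)) = G y) ->
  differentiable phi (rsubmx x) ->
  forall v, 'd G x v = row_mx (lsubmx v) ('d phi (rsubmx x) (rsubmx v)).
Proof.
move=> E dphi v.
pose L1 : {linear 'rV[R]_1 -> W} := mulmxr (row_mx 1%:M 0).
pose L2 : {linear 'rV[R]_m -> W} := mulmxr (row_mx 0 1%:M).
have dl : differentiable (lsubmx : W -> 'rV[R]_1) x by exact: differentiable_lsubmx.
have dr : differentiable (rsubmx : W -> 'rV[R]_m) x by exact: differentiable_rsubmx.
have [d1 E1] := diff_linear_comp (@linear_rV_continuous _ _ _ L1) dl.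
have dpr : differentiable (phi \o rsubmx) x by exact: (differentiable_comp dr dphi).
have [d2 E2] := diff_linear_comp (@linear_rV_continuous _ _ _ L2) dpr.
have d3 := differentiableD d1 d2.
have dc : differentiable (cst (row_mx c 0) : W -> W) x by exact: differentiable_cst.
have dH := differentiableD dc d3.
have HE : (fun y => row_mx (c + lsubmx y) (phi (rsubmx y))) =
    cst (row_mx c 0) + ((L1 \o lsubmx) + (L2 \o (phi \o rsubmx))) :> (W -> W).
  apply: funext => y; rewrite !fctE /= !mul_mx_row !mulmx1 !mulmx0.
  by rewrite !add_row_mx !add0r !addr0.
have {}E : {near x, (cst (row_mx c 0) + ((L1 \o lsubmx) + (L2 \o (phi \o rsubmx)))) =1 G}.
  by apply: filterS E => y <-; exact: (congr1 (fun h : W -> W => h y) (esym HE)).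
have [_ H] := near_eq_differentiable E dH.
apply: etrans (congr1 (fun h : W -> W => h v) H) _.
apply: etrans (congr1 (fun h : W -> W => h v) (diffD dc d3)) _.
apply: etrans (congr1 (fun h : W -> W => _ + h v) (diffD d1 d2)) _.
apply: etrans (congr1 (fun h : W -> W => h v + _) (diff_cst (row_mx c 0 : W) x)) _.
apply: etrans (congr1 (fun h : W -> W => _ + (h v + _)) E1) _.
apply: etrans (congr1 (fun h : W -> W => _ + (_ + h v)) E2) _.
apply: etrans (congr1 (fun h : W -> 'rV_m => _ + (_ + L2 (h v))) (diff_comp dr dphi)) _.
apply: etrans (congr1 (fun h : W -> 'rV_1 => _ + (L1 (h v) + _))
  (diff_lin x (@continuous_lsubmx R 1 1 m))) _.
apply: etrans (congr1 (fun h : W -> 'rV_m => _ + (_ + L2 ('d phi _ (h v))))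
  (diff_lin x (@continuous_rsubmx R 1 1 m))) _.
rewrite /= add0r !mul_mx_row !mulmx1 !mulmx0.
by rewrite add_row_mx addr0 add0r.
Qed.

Lemma near_tcoord x e : 0 < e -> \forall y \near x, `|tcoord y - tcoord x| < e.
Proof.
move=> e0; have /cvgrPdist_lt/(_ _ e0) := @tcoord_continuous x.
by apply: filterS => y; rewrite distrC.
Qed.

Lemma S1xM_transition_diff p x v : cimg p x ->
  'd (cmap (cinv p x : N) \o @cinv _ _ N p) x v =
  row_mx (lsubmx v) ('d (transition p.2 (cinv p.2 (rsubmx x))) (rsubmx x) (rsubmx v)).
Proof.
move=> /S1xM_cimgP[_ px].
apply: (@diff_block _ (const_mx (of_circle (to_circle (tcoord x)) - tcoord x))).
  near=> y; rewrite /= (@circle_lift_to_circle _ _ (tcoord x)) ?of_circleK//.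
    congr row_mx; apply/rowP => i; rewrite !ord1 [RHS]mxE !mxE /tcoord !mxE.
    ring.
  near: y; exact/near_tcoord/pi_gt0.
exact: (transition_differentiable sm (overlap_self sm px)).
Unshelve. all: by end_near. Qed.

Lemma tangent_snd p v : tangent (snd : N -> M) p v = rsubmx v.
Proof.
rewrite /tangent.
have dr : differentiable (rsubmx : W -> 'rV[R]_m) (cmap p p).
  exact: differentiable_rsubmx.
have E : {near (cmap p p : W), rsubmx =1 (cmap (snd p) \o snd \o @cinv _ _ N p)}.
  apply: (open_near (@S1xM_cimg_open p) (S1xM_cimg_center p)) => y.
  by move=> /S1xM_cimgP[_ /(cimgP sm)[_ /= ->]].
have [_ H] := near_eq_differentiable E dr.
apply: etrans (congr1 (fun h : W -> 'rV_m => h v) H) _.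
exact: (congr1 (fun h : W -> 'rV_m => h v) (diff_lin _ (@continuous_rsubmx R 1 1 m))).
Qed.

Lemma tangent_fst p v : tangent (fst : N -> circle R) p v = lsubmx v.
Proof.
rewrite /tangent.
have dl : differentiable (lsubmx : W -> 'rV[R]_1) (cmap p p).
  exact: differentiable_lsubmx.
have E : {near (cmap p p : W), lsubmx =1
    (cmap (fst p : circle R) \o fst \o @cinv _ _ N p)}.
  apply: (open_near (@S1xM_cimg_open p) (S1xM_cimg_center p)) => y.
  move=> /S1xM_cimgP[py _]; apply/rowP => i; rewrite !ord1 [RHS]mxE.
  by rewrite (@circle_lift_to_circle _ _ (of_circle p.1))// addrC subrK.
have [_ H] := near_eq_differentiable E dl.
apply: etrans (congr1 (fun h : W -> 'rV_1 => h v) H) _.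
exact: (congr1 (fun h : W -> 'rV_1 => h v) (diff_lin _ (@continuous_lsubmx R 1 1 m))).
Qed.

(** In charts the action translates t and fixes the coordinates of M; invariance of a form thus
    becomes equality of its values along orbits. *)
Lemma tangent_act (s : circle R) p v : tangent (S1_act s) p v = v.
Proof.
rewrite /tangent.
have [d1 d2] := is_diff_id (rsubmx (cmap p p : W)).
pose r := of_circle (circle_add s p.1).
apply: etrans (@diff_block _ (const_mx (r - of_circle p.1)) id _ _ _ _) _.
- apply: (open_near (@S1xM_cimg_open p) (S1xM_cimg_center p)) => y.
  move=> /S1xM_cimgP[py /(cimgP sm)[_ yE]] /=; rewrite yE circle_addE.
  rewrite (@circle_lift_to_circle _ _ (of_circle s + of_circle p.1)).
  + congr row_mx; apply/rowP => i; rewrite !ord1 !mxE -/r /tcoord; ring.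
  + by rewrite of_circleK.
  + by rewrite opprD addrACA subrr add0r.
- exact: d1.
apply: etrans (congr1 (fun h : 'rV_m -> 'rV_m => row_mx _ (h _)) d2) _.
by rewrite hsubmxK.
Qed.

Lemma dtE p (v : 'I_1 -> W) : @dt _ _ M p v = tcoord (v ord0).
Proof. by rewrite /dt /pullback /circle_dt tangent_fst. Qed.

Lemma pullback_sndE k (a : kfield M k) p u :
  pullback (snd : N -> M) a p u = a p.2 (fun i => rsubmx (u i)).
Proof. by rewrite /pullback; under eq_fun do rewrite tangent_snd. Qed.

Lemma S1_invariantP k (w : kfield N k) :
  S1_invariant w <-> forall s p u, w (S1_act s p) u = w p u.
Proof.
have E s p (u : 'I_k -> W) : pullback (S1_act s) w p u = w (S1_act s p) u.
  by rewrite /pullback; under eq_fun do rewrite tangent_act.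
split=> [H s p u|H s]; first by rewrite -E H.
by apply: funext => p; apply: funext => u; rewrite E.
Qed.

Lemma S1xM_in_chart k (w : kfield N k) p x u : cimg p x ->
  in_chart w p x u = w (cinv p x) (fun i => row_mx (lsubmx (u i))
    ('d (transition p.2 (cinv p.2 (rsubmx x))) (rsubmx x) (rsubmx (u i)))).
Proof.
move=> px; rewrite /in_chart; congr (w _ _); apply: funext => i.
exact: S1xM_transition_diff.
Qed.

Lemma in_chart_pullback_snd k (a : kfield M k) p x u : cimg p x ->
  in_chart (pullback (snd : N -> M) a) p x u =
  in_chart a p.2 (rsubmx x) (fun i => rsubmx (u i)).
Proof.
move=> px; rewrite S1xM_in_chart// pullback_sndE; congr (a _ _).
by apply: funext => i; rewrite row_mxKr.
Qed.

Lemma diff_rsubmx (g : 'rV[R]_m -> R) x : differentiable g (rsubmx x) ->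
  differentiable (fun y : W => g (rsubmx y)) x /\
  forall v, 'd (fun y : W => g (rsubmx y)) x v = 'd g (rsubmx x) (rsubmx v).
Proof.
move=> dg; have dr : differentiable (rsubmx : W -> 'rV[R]_m) x.
  exact: differentiable_rsubmx.
split=> [|v]; first exact: (differentiable_comp dr dg).
apply: etrans (congr1 (fun h : W -> R => h v) (diff_comp dr dg)) _.
exact: (congr1 (fun h : W -> 'rV_m => 'd g _ (h v)) (diff_lin _ (@continuous_rsubmx R 1 1 m))).
Qed.

End ProductChart.

(** * The map S and its inverse *)

Section WedgeOneForm.
Variables (R : realType) (m : nat).

Lemma sum_lift_perm l (F : 'S_l.+1 -> R) :
  \sum_s F s = \sum_(i < l.+1) \sum_(t : 'S_l) F (lift_perm ord0 i t).
Proof.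
rewrite pair_big /= (reindex (fun it : 'I_l.+1 * 'S_l => lift_perm ord0 it.1 it.2))//.
apply: onW_bij; apply: inj_card_bij => [[i t] [i' t'] /= E|].
  have ii' : i = i' by rewrite -(lift_perm_id ord0 i t) E lift_perm_id.
  congr pair => //; apply/permP => k; apply: (@lift_inj _ i).
  by rewrite -(lift_perm_lift ord0) E {1}ii' lift_perm_lift -ii'.
by rewrite card_prod card_ord !card_Sn factS.
Qed.

(** The [l]! permutations sending position 0 to [i] contribute equal terms, which cancels the
    normalization; [lift_perm ord0 i t] has the sign of [t] times (-1)^i. *)
Lemma wedge_1E (M : charted R m) l (a : kfield M 1) (b : kfield M l) p v :
  (forall u (t : 'S_l), b p (fun j => u (t j)) = (-1) ^+ t * b p u) ->
  wedge a b p v = \sum_(i < l.+1)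
    (-1) ^+ i * (a p (fun=> v i) * b p (fun j => v (lift i j))).
Proof.
move=> bt; rewrite /wedge (@sum_lift_perm l).
under eq_bigr => i _.
  rewrite (eq_bigr (fun=> (-1) ^+ i * (a p (fun=> v i) * b p (fun j => v (lift i j))))).
    over.
  move=> t _.
  have -> : (fun k : 'I_1 => v (lift_perm ord0 i t (lshift l k))) = fun=> v i.
    apply: funext => k; have -> : lshift l k = ord0 by apply: val_inj; rewrite ord1.
    by rewrite lift_perm_id.
  have -> : (fun j => v (lift_perm ord0 i t (rshift 1 j))) = fun j => v (lift i (t j)).
    apply: funext => j; have -> : rshift 1 j = lift ord0 j by apply: val_inj.
    by rewrite lift_perm_lift.
  rewrite (bt (fun j => v (lift i j))) odd_lift_perm /= signr_addb signr_odd.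
  by rewrite -!mulrA; congr (_ * _); rewrite mulrCA signrMK.
under eq_bigr do rewrite sumr_const card_Sn.
rewrite sumrMnl mul1n -[X in _ * X]mulr_natl mulrA mulVf ?mul1r//.
Qed.

Lemma form1_perm (f : ('I_1 -> 'rV[R]_m) -> R) u (t : 'S_1) :
  f (fun j => u (t j)) = (-1) ^+ t * f u.
Proof.
have -> : t = 1%g by apply/permP => i; rewrite !ord1.
by rewrite odd_perm1 mul1r; congr f; apply: funext => j; rewrite perm1.
Qed.

Lemma form2_perm (f : ('I_2 -> 'rV[R]_m) -> R) u (t : 'S_2) :
  (forall x y, f (tnth [tuple x; y]) = - f (tnth [tuple y; x])) ->
  f (fun j => u (t j)) = (-1) ^+ t * f u.
Proof.
move=> fa; rewrite [fun j => _]vec2E [in RHS](vec2E u).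
have [t0|t0] := ord2P (t ord0); have [t1|t1] := ord2P (t ord_max).
- by have := congr1 val (perm_inj (etrans t0 (esym t1))).
- have -> : t = 1%g.
    by apply/permP => i; rewrite perm1; have [->|->] := ord2P i.
  by rewrite !perm1 odd_perm1 mul1r.
- have -> : t = tperm ord0 ord_max.
    by apply/permP => i; have [->|->] := ord2P i; rewrite ?tpermL ?tpermR.
  by rewrite tpermL tpermR odd_tperm /= mulN1r fa.
- by have := congr1 val (perm_inj (etrans t0 (esym t1))).
Qed.

End WedgeOneForm.

Section SmapFormula.
Variables (R : realType) (m : nat) (M : charted R m).
Hypothesis sm : smooth_atlas M.
Local Notation N := (S1xM M).
Local Notation W := 'rV[R]_(1 + m).
Implicit Types (p : N).

Lemma lift_I2 (k : 'I_1) :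
  (lift ord0 k = ord_max :> 'I_2) * (lift ord_max k = ord0 :> 'I_2).
Proof. by split; apply: val_inj; rewrite ord1. Qed.

Lemma wedge_dt_1E (b : kfield N 1) p v : wedge (@dt _ _ M) b p v =
  tcoord (v ord0) * b p (fun=> v ord_max) - tcoord (v ord_max) * b p (fun=> v ord0).
Proof.
rewrite wedge_1E => [|u t]; last exact: form1_perm.
rewrite big_ord_recl big_ord1 lift_I2 !(dtE sm) mul1r expr1 mulN1r.
by congr (_ * b p _ - _ * b p _); apply: funext => k; rewrite !lift_I2.
Qed.

Lemma pull_vec2 (v : 'I_2 -> W) :
  (fun i => rsubmx (v i)) = tnth [tuple rsubmx (v ord0); rsubmx (v ord_max)].
Proof. exact: vec2E. Qed.

Section OneForm.
Variable a : kfield M 1.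
Hypothesis af : is_form a.
Local Notation c := (coef a).

(** In a product chart the coefficients of pi^*a depend on the coordinates of M only, hence d
    commutes with pi^*. *)
Lemma dext_pullback_snd p v :
  dext (pullback (snd : N -> M) a) p v = dext a p.2 (fun i => rsubmx (v i)).
Proof.
have y0E : rsubmx (cmap p p : W) = cmap p.2 p.2 by rewrite row_mxKr.
have D (i : 'I_2) : 'D_(v i) (fun x => in_chart (pullback (snd : N -> M) a) p x
      (fun j => v (lift i j))) (cmap p p) =
    'd (c p.2 ^~ (rsubmx (v (lift i ord0)))) (cmap p.2 p.2) (rsubmx (v i)).
  have dc : differentiable (c p.2 ^~ (rsubmx (v (lift i ord0)))) (rsubmx (cmap p p : W)).
    by rewrite y0E; exact: (coef_differentiable af _ (cimg_center sm _)).
  have [d1 d2] := diff_rsubmx dc.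
  have E : {near (cmap p p : W),
      (fun x => in_chart (pullback (snd : N -> M) a) p x (fun j => v (lift i j))) =1
      (fun y => c p.2 (rsubmx y) (rsubmx (v (lift i ord0))))}.
    apply: (open_near (@S1xM_cimg_open _ _ _ sm p) (S1xM_cimg_center sm p)) => x px.
    rewrite (in_chart_pullback_snd sm _ _ px) /coef; congr in_chart.
    exact: vec1E.
  apply: etrans (near_eq_derive _ E) _.
  apply: etrans (deriveE _ d1) _.
  by apply: etrans (d2 _) _; rewrite y0E.
rewrite (dext1E sm af) /dext big_ord_recl big_ord1 mul1r expr1 mulN1r.
apply: (congr2 (fun s t : R => s - t)); apply: etrans (D _) _.
  by rewrite lift_I2.
rewrite lift_I2 (_ : lift ord_max ord0 = ord0)//; exact: (lift_I2 _).2.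
Qed.

Lemma SmapE p v : Smap M a p v =
  tcoord (v ord0) * a p.2 (fun=> rsubmx (v ord_max)) -
  tcoord (v ord_max) * a p.2 (fun=> rsubmx (v ord0)) +
  dext a p.2 (tnth [tuple rsubmx (v ord0); rsubmx (v ord_max)]).
Proof.
by rewrite /Smap /Dtw wedge_dt_1E !(pullback_sndE sm) dext_pullback_snd pull_vec2.
Qed.

(** Being valid on the whole chart image, and not only at its center, this formula can be
    differentiated: smoothness and D-closedness of S(a) rest on it. *)
Lemma in_chart_Smap p x v : cimg p x -> in_chart (Smap M a) p x v =
  tcoord (v ord0) * c p.2 (rsubmx x) (rsubmx (v ord_max)) -
  tcoord (v ord_max) * c p.2 (rsubmx x) (rsubmx (v ord0)) +
  ('d (c p.2 ^~ (rsubmx (v ord_max))) (rsubmx x) (rsubmx (v ord0)) -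
   'd (c p.2 ^~ (rsubmx (v ord0))) (rsubmx x) (rsubmx (v ord_max))).
Proof.
move=> px; have [_ px2] := (S1xM_cimgP p x).1 px.
have D := in_chart_dext sm af (tnth [tuple rsubmx (v ord0); rsubmx (v ord_max)]) px2.
apply: etrans (congr1 (fun t : R => _ + t) D).
rewrite (S1xM_in_chart sm _ _ px) SmapE /tcoord !row_mxKl !row_mxKr.
congr (_ + dext a _ _); apply: funext => i.
by have [->|->] := ord2P i.
Qed.

Lemma dext_bilinear (q : M) (z : 'rV[R]_m) k x y :
  dext a q (tnth [tuple z; k *: x + y]) =
  k * dext a q (tnth [tuple z; x]) + dext a q (tnth [tuple z; y]).
Proof.
rewrite !(dext1E sm af) !(tnth_nth 0) /=.
have dc e : differentiable (c q ^~ e) (cmap q q).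
  exact: (coef_differentiable af _ (cimg_center sm q)).
have cE : c q ^~ (k *: x + y) = (k *: (c q ^~ x) + c q ^~ y).
  by apply: funext => t; rewrite (coef_linear af).
have D : 'd (c q ^~ (k *: x + y)) (cmap q q) z =
    k * 'd (c q ^~ x) (cmap q q) z + 'd (c q ^~ y) (cmap q q) z.
  rewrite cE; apply: etrans (congr1 (fun h : 'rV[R]_m -> R => h z)
    (diffD (differentiableZ k (dc x)) (dc y))) _.
  exact: (congr1 (fun h : 'rV[R]_m -> R => h z + _) (diffZ k (dc x))).
have aux (s t s' t' : R) : k * s + t - (k *: s' + t') = k * (s - s') + (t - t').
  by rewrite /GRing.scale /=; ring.
apply: etrans (congr2 (fun s t : R => s - t) D (linearP _ k x y)) _.
exact: aux.
Qed.

Lemma dext_antisym (q : M) (x y : 'rV[R]_m) :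
  dext a q (tnth [tuple x; y]) = - dext a q (tnth [tuple y; x]).
Proof. by rewrite !(dext1E sm af) !(tnth_nth 0) /= opprB. Qed.

End OneForm.

End SmapFormula.

(** * S(a) is a smooth, invariant, D-closed 2-form *)

Section SmapForm.
Variables (R : realType) (m : nat) (M : charted R m).
Hypothesis sm : smooth_atlas M.
Local Notation N := (S1xM M).
Local Notation W := 'rV[R]_(1 + m).
Implicit Types (p : N).

Lemma tnth2_0 (T : Type) (x y : T) : tnth [tuple x; y] ord0 = x.
Proof. by []. Qed.

Lemma tnth2_1 (T : Type) (x y : T) : tnth [tuple x; y] ord_max = y.
Proof. by []. Qed.

Lemma lift_I3 :
  (lift ord0 (ord0 : 'I_2) = inord 1 :> 'I_3) *
  (lift ord0 (ord_max : 'I_2) = ord_max :> 'I_3) *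
  (lift (inord 1) (ord0 : 'I_2) = ord0 :> 'I_3) *
  (lift (inord 1) (ord_max : 'I_2) = ord_max :> 'I_3) *
  (lift ord_max (ord0 : 'I_2) = ord0 :> 'I_3) *
  (lift ord_max (ord_max : 'I_2) = inord 1 :> 'I_3).
Proof. by do !split; apply: val_inj; rewrite /= ?inordK. Qed.

Lemma big_I3 (F : 'I_3 -> R) :
  \sum_(i < 3) (-1) ^+ i * F i = F ord0 - F (inord 1) + F ord_max.
Proof.
rewrite big_ord_recl big_ord_recl big_ord1 mul1r expr1 mulN1r addrA.
have -> : lift ord0 (ord0 : 'I_2) = inord 1 :> 'I_3 by rewrite lift_I3.
have -> : lift ord0 (lift ord0 (ord0 : 'I_1)) = ord_max :> 'I_3 by apply: val_inj.
by rewrite sqrrN expr1n mul1r.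
Qed.

Lemma wedge_dt_2E (b : kfield N 2) p (v : 'I_3 -> W) :
  (forall x y, b p (tnth [tuple x; y]) = - b p (tnth [tuple y; x])) ->
  wedge (@dt _ _ M) b p v =
  tcoord (v ord0) * b p (tnth [tuple v (inord 1); v ord_max]) -
  tcoord (v (inord 1)) * b p (tnth [tuple v ord0; v ord_max]) +
  tcoord (v ord_max) * b p (tnth [tuple v ord0; v (inord 1)]).
Proof.
move=> ba; rewrite wedge_1E => [|u t]; last exact: form2_perm.
rewrite (@big_I3 (fun i => dt p (fun=> v i) * b p (fun j => v (lift i j)))).
by rewrite !(dtE sm) ![fun j => v (lift _ j)]vec2E !lift_I3.
Qed.

(* D(D(pi^* a)) = 0 in coordinates: [t] stands for dt, [b] for the coefficients
   of [a], [d1] and [d2] for their first and second derivatives. *)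
Lemma closed_identity (I : Type) (t b : I -> R) (d1 : I -> I -> R)
    (d2 : I -> I -> I -> R) (i j k : I) :
  (forall k j i, d2 k j i = d2 k i j) ->
  t i * (t j * b k - t k * b j + (d1 k j - d1 j k)) -
  t j * (t i * b k - t k * b i + (d1 k i - d1 i k)) +
  t k * (t i * b j - t j * b i + (d1 j i - d1 i j)) +
  (t j * d1 k i - t k * d1 j i + (d2 k j i - d2 j k i) -
   (t i * d1 k j - t k * d1 i j + (d2 k i j - d2 i k j)) +
   (t i * d1 j k - t j * d1 i k + (d2 j i k - d2 i j k))) = 0.
Proof. by move=> d2C; rewrite (d2C k j i) (d2C j k i) (d2C i k j); ring. Qed.

Section OneForm.
Variable a : kfield M 1.
Hypothesis af : is_form a.
Local Notation c := (coef a).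

Lemma Smap_bilinear p :
  (forall z k x y, Smap M a p (tnth [tuple z; k *: x + y]) =
    k * Smap M a p (tnth [tuple z; x]) + Smap M a p (tnth [tuple z; y])) /\
  (forall x y, Smap M a p (tnth [tuple x; y]) = - Smap M a p (tnth [tuple y; x])).
Proof.
have [/(_ p.2)[/multilinear1 al _] _] := af.
split=> [z k x y|x y]; rewrite !(SmapE sm af) !(tnth2_0, tnth2_1).
  rewrite linearP tcoord_linear al (dext_bilinear sm af).
  ring.
by rewrite (dext_antisym sm af); ring.
Qed.

Lemma Smap_form : is_form (Smap M a).
Proof.
split=> [p|p v]; first by apply/multilinear_alternating2; exact: Smap_bilinear.
have oc := @cimg_open _ _ _ sm p.2.
pose g (y : 'rV[R]_m) : R :=
  tcoord (v ord0) *: c p.2 y (rsubmx (v ord_max)) +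
  (- tcoord (v ord_max)) *: c p.2 y (rsubmx (v ord0)) +
  ('d (c p.2 ^~ (rsubmx (v ord_max))) y (rsubmx (v ord0)) +
   (-1) *: 'd (c p.2 ^~ (rsubmx (v ord0))) y (rsubmx (v ord_max))).
have cs e := @coef_smooth _ _ _ _ af p.2 e.
have gs : smooth_on (cimg p.2) g.
  apply: smooth_onD => //; first by apply: smooth_onD => //; apply: smooth_onZ.
  apply: smooth_onD => //; first exact: smooth_on_diff.
  by apply: smooth_onZ => //; exact: smooth_on_diff.
have gr := smooth_on_affine 0 (L := rsubmx : {linear W -> _}) oc
  (@continuous_rsubmx R 1 1 m) gs.
have {}gr : smooth_on (cimg p) (fun x : W => g (0 + rsubmx x)).
  apply: smooth_on_sub gr => x /S1xM_cimgP[_].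
  by rewrite /= add0r.
apply: smooth_on_ext gr; first exact: S1xM_cimg_open.
move=> x px; apply: etrans (esym (in_chart_Smap sm af _ px)).
by rewrite add0r /g scaleNr scaleN1r.
Qed.

Lemma Smap_invariant : S1_invariant (Smap M a).
Proof. by apply/(S1_invariantP sm) => s p v; rewrite !(SmapE sm af). Qed.

Lemma Smap_closed p v : Dtw (Smap M a) p v = 0.
Proof.
have y0E : rsubmx (cmap p p : W) = cmap p.2 p.2 by rewrite row_mxKr.
pose y0 : 'rV[R]_m := cmap p.2 p.2.
have py0 : cimg p.2 y0 := cimg_center sm p.2.
pose t i := tcoord (v i).
pose e i := rsubmx (v i).
(* First and second derivatives at the center of the coefficient of [a] on [e k]; the components
   [t i] are constants, so differentiation does not affect them. *)
pose d1 k i := 'd (c p.2 ^~ (e k)) y0 (e i).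
pose d2 k j i := 'd (fun y => 'd (c p.2 ^~ (e k)) y (e j)) y0 (e i).
have cs k := @coef_smooth _ _ _ _ af p.2 (e k).
have d2C k j i : d2 k j i = d2 k i j.
  exact: (second_derivative_sym _ _ (@cimg_open _ _ _ sm p.2) py0 (cs k 2)).
have D i j k :
    'D_(v i) (fun x => in_chart (Smap M a) p x (tnth [tuple v j; v k])) (cmap p p) =
    t j * d1 k i - t k * d1 j i + (d2 k j i - d2 j k i).
  pose g : 'rV[R]_m -> R := (t j *: (c p.2 ^~ (e k)) - t k *: (c p.2 ^~ (e j))) +
    ((fun y => 'd (c p.2 ^~ (e k)) y (e j)) - (fun y => 'd (c p.2 ^~ (e j)) y (e k))).
  have dc l : differentiable (c p.2 ^~ (e l)) y0.
    exact: smooth_on_differentiable (cs l) py0.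
  have dd l l' : differentiable (fun y => 'd (c p.2 ^~ (e l)) y (e l')) y0.
    exact: smooth_on_differentiable (smooth_on_diff (e l') (cs l)) py0.
  have dZ l l' := differentiableZ (t l') (dc l).
  have dg1 := differentiableB (dZ k j) (dZ j k).
  have dg2 := differentiableB (dd k j) (dd j k).
  have dg : differentiable g (rsubmx (cmap p p : W)).
    by rewrite y0E; exact: (differentiableD dg1 dg2).
  have [h1 h2] := diff_rsubmx dg.
  have E : {near (cmap p p : W),
      (fun x => in_chart (Smap M a) p x (tnth [tuple v j; v k])) =1
      (fun y => g (rsubmx y))}.
    apply: (open_near (@S1xM_cimg_open _ _ _ sm p) (S1xM_cimg_center sm p)) => x px.
    exact: (in_chart_Smap sm af _ px).
  apply: etrans (near_eq_derive _ E) _.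
  apply: etrans (deriveE _ h1) _.
  apply: etrans (h2 _) _; rewrite y0E.
  apply: etrans (congr1 (fun h : 'rV[R]_m -> R => h (e i)) (diffD dg1 dg2)) _.
  apply: etrans (congr1 (fun h : 'rV[R]_m -> R => h (e i) + _) (diffB (dZ k j) (dZ j k))) _.
  apply: etrans (congr1 (fun h : 'rV[R]_m -> R => _ + h (e i)) (diffB (dd k j) (dd j k))) _.
  apply: etrans (congr1 (fun h : 'rV[R]_m -> R => h (e i) - _ + _) (diffZ (t j) (dc k))) _.
  exact: (congr1 (fun h : 'rV[R]_m -> R => _ - h (e i) + _) (diffZ (t k) (dc j))).
have B j k : Smap M a p (tnth [tuple v j; v k]) = t j * a p.2 (fun=> e k) -
    t k * a p.2 (fun=> e j) + (d1 k j - d1 j k).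
  rewrite (SmapE sm af) !(tnth2_0, tnth2_1); congr (_ + _).
  exact: (dext1E sm af).
have [_ ba] := Smap_bilinear p.
rewrite /Dtw (wedge_dt_2E _ ba) /dext.
rewrite (@big_I3 (fun i => 'D_(v i) (fun x => in_chart (Smap M a) p x
  (fun j => v (lift i j))) (cmap p p))).
rewrite ![fun j => v (lift _ j)]vec2E !lift_I3 !D !B.
exact: (@closed_identity _ t (fun k => a p.2 (fun=> e k)) d1 d2).
Qed.

End OneForm.

End SmapForm.

Section SmapNondegenerate.
Variables (R : realType) (m : nat) (M : charted R m).
Hypothesis sm : smooth_atlas M.
Local Notation N := (S1xM M).
Local Notation W := 'rV[R]_(1 + m).

Lemma tcoord_row_mx (s : R) (u : 'rV[R]_m) : tcoord (row_mx (const_mx s) u) = s.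
Proof. by rewrite /tcoord row_mxKl mxE. Qed.

Lemma tcoord0E (u : 'rV[R]_m) : tcoord (row_mx 0 u) = 0.
Proof. by rewrite /tcoord row_mxKl mxE. Qed.

Lemma row_mx_tcoord (v : W) : row_mx (const_mx (tcoord v)) (rsubmx v) = v.
Proof.
rewrite -[RHS]hsubmxK; congr row_mx.
by apply/rowP => i; rewrite !ord1 [LHS]mxE.
Qed.

(** By [SmapE], S(a) at (s, q) is dt /\ a + da on R x T_qM, whatever s is; this is the linear
    algebra of [contact_nondegenerate] at each q. *)
Lemma Smap_nondegenerate j (a : kfield M 1) : m = (1 + j * 2)%N -> is_form a ->
  Defs.nondegenerate (Smap M a) <->
  forall q : M, exists v, wedge a (wedge_pow (dext a) j) q v != 0.
Proof.
move=> mE af.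
have H q : (exists v, wedge a (wedge_pow (dext a) j) q v != 0) <->
    (forall (u0 : R) (u : 'rV[R]_m), (u0 != 0) || (u != 0) ->
    exists v0 v, u0 * a q (fun=> v) - v0 * a q (fun=> u) +
      dext a q (tnth [tuple u; v]) != 0).
  apply: contact_nondegenerate => //.
  - by have [/(_ q)[/multilinear1 al _] _] := af.
  - exact: dext_bilinear.
  - exact: dext_antisym.
split=> [nd q|nd p u unz].
  apply/H => u0 u unz; have [|w] := nd (to_circle 0, q) (row_mx (const_mx u0) u).
    apply: contraTneq unz => E; rewrite negb_or !negbK.
    have -> : u0 = 0 by rewrite -(tcoord_row_mx u0 u) E /tcoord linear0 mxE.
    have -> : u = 0 by rewrite -(row_mxKr (const_mx u0 : 'rV_1) u) E linear0.
    by rewrite !eqxx.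
  rewrite (SmapE sm af) !(tnth2_0, tnth2_1) tcoord_row_mx row_mxKr => Hw.
  by exists (tcoord w), (rsubmx w).
have [|v0 [v Hv]] := (H p.2).1 (nd p.2) (tcoord u) (rsubmx u).
  apply: contraNT unz; rewrite negb_or !negbK => /andP[/eqP u0 /eqP u1].
  by rewrite -(row_mx_tcoord u) u0 u1; apply/eqP; exact: row_mx0.
exists (row_mx (const_mx v0) v).
by rewrite (SmapE sm af) !(tnth2_0, tnth2_1) tcoord_row_mx row_mxKr.
Qed.

End SmapNondegenerate.

(** * Recovering the contact form by contraction with d/dt *)

Section Inverse.
Variables (R : realType) (m : nat) (M : charted R m).
Hypothesis sm : smooth_atlas M.
Local Notation N := (S1xM M).
Local Notation W := 'rV[R]_(1 + m).

Definition ddt : W := row_mx (const_mx 1) 0.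

Definition horizontal (e : 'rV[R]_m) : W := row_mx 0 e.

Lemma horizontal_linear k e e' :
  horizontal (k *: e + e') = k *: horizontal e + horizontal e'.
Proof. by rewrite /horizontal scale_row_mx add_row_mx scaler0 addr0. Qed.

(* The inverse of [Smap]: by invariance, nothing is lost by restricting to the
   slice over [to_circle 0]. *)
Definition contraction (b : kfield N 2) : kfield M 1 :=
  fun q v => b (to_circle 0, q) (tnth [tuple ddt; horizontal (v ord0)]).

Lemma contraction_Smap (a : kfield M 1) : is_form a -> contraction (Smap M a) = a.
Proof.
move=> af; apply: funext => q; apply: funext => v.
rewrite /contraction (SmapE sm af) !(tnth2_0, tnth2_1) tcoord_row_mx tcoord0E.
rewrite mul1r mul0r subr0 !row_mxKr [in RHS](vec1E v).
suff -> : dext a q (tnth [tuple 0; v ord0]) = 0 by rewrite addr0.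
rewrite (dext_antisym sm af).
have := dext_bilinear sm af q (v ord0) 1 0 0.
rewrite scaler0 addr0 mul1r; move: (dext _ _ _) => t tE; lra.
Qed.

Section Beta.
Variable b : kfield N 2.
Hypotheses (bf : is_form b) (binv : S1_invariant b)
  (bclosed : forall p v, Dtw b p v = 0).

Lemma b_slice (p : N) v : b p v = b (to_circle 0, p.2) v.
Proof.
rewrite -[RHS]((S1_invariantP sm b).1 binv p.1); congr (b _ v).
case: p => s q; rewrite /S1_act /=; congr pair.
by apply: esym; apply: etrans (circle_addE s 0) _; rewrite addr0 of_circleK.
Qed.

Lemma b_bilinear (p : N) :
  (forall z k x y, b p (tnth [tuple z; k *: x + y]) =
    k * b p (tnth [tuple z; x]) + b p (tnth [tuple z; y])) /\
  (forall x y, b p (tnth [tuple x; y]) = - b p (tnth [tuple y; x])).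
Proof. by apply/multilinear_alternating2; have [/(_ p)] := bf. Qed.

(** Changes of product charts fix [ddt] and preserve horizontal vectors, and by [b_slice] the circle
    coordinate of the base point is irrelevant. *)
Lemma coef_contraction (p : N) x e : cimg p x ->
  in_chart b p x (tnth [tuple ddt; horizontal e]) =
  coef (contraction b) p.2 (rsubmx x) e.
Proof.
move=> px; rewrite (S1xM_in_chart sm _ _ px) b_slice /coef /in_chart /contraction /=.
congr (b _ _); apply: funext => i; have [->|->] := ord2P i; rewrite !(tnth2_0, tnth2_1).
  by rewrite row_mxKl row_mxKr linear0.
by rewrite row_mxKl row_mxKr.
Qed.

Lemma contraction_form : is_form (contraction b).
Proof.
split=> [q|q v].
  split; last exact: alternating1.
  apply/multilinear1 => k x y; rewrite /contraction horizontal_linear.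
  by have [-> _] := b_bilinear (to_circle 0, q).
pose p : N := (to_circle 0, q).
have [_ /(_ p (tnth [tuple ddt; horizontal (v ord0)])) bs] := bf.
(* Inclusion of the slice through the center of the chart; its t-coordinate is the chosen
   representative of [to_circle 0], which may differ from 0. *)
pose L : {linear 'rV[R]_m -> W} := mulmxr (row_mx 0 1%:M).
have LE y : row_mx (const_mx (of_circle p.1)) 0 + L y =
    row_mx (const_mx (of_circle p.1)) y.
  by rewrite /L /= mul_mx_row mulmx0 mulmx1 add_row_mx addr0 add0r.
have U y : cimg q y -> cimg p (row_mx (const_mx (of_circle p.1)) y).
  move=> qy; apply/S1xM_cimgP; rewrite tcoord_row_mx row_mxKr subrr normr0.
  by split=> //; exact: pi_gt0.
have := smooth_on_affine (row_mx (const_mx (of_circle p.1)) 0)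
  (@S1xM_cimg_open _ _ _ sm p) (@linear_rV_continuous _ _ _ L) bs.
move=> /(smooth_on_sub (U' := cimg q)) H.
apply: smooth_on_ext (H _); first exact: cimg_open.
- move=> y qy; rewrite LE (coef_contraction _ (U y qy)) row_mxKr /coef.
  by congr in_chart; rewrite [RHS]vec1E.
- by move=> y qy; rewrite /= LE; exact: U.
Qed.

(** Near the center, the coefficient equals its composite with the affine projection freezing t at
    its central value ([c + L y]), and [L] kills [ddt]. *)
Lemma derive_orbit (p : N) u w :
  'D_ddt (fun x => in_chart b p x (tnth [tuple horizontal u; horizontal w]))
    (cmap p p) = 0.
Proof.
pose f x := in_chart b p x (tnth [tuple horizontal u; horizontal w]).
have cp := S1xM_cimg_center sm p; have op := @S1xM_cimg_open _ _ _ sm p.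
have [_ /(_ p (tnth [tuple horizontal u; horizontal w])) bs] := bf.
pose L : {linear W -> W} := mulmxr (block_mx 0 0 0 1%:M).
pose c : W := row_mx (lsubmx (cmap p p : W)) 0.
have LE (y : W) : c + L y = row_mx (lsubmx (cmap p p : W)) (rsubmx y).
  rewrite /L /= -{1}[y]hsubmxK mul_row_block !mulmx0 mulmx1 add0r.
  by rewrite /c add_row_mx addr0 !add0r.
have cL : c + L (cmap p p) = cmap p p by rewrite LE hsubmxK.
have df : differentiable f (c + L (cmap p p)).
  by rewrite cL; exact: smooth_on_differentiable bs cp.
have [d1 d2] := diff_affine (@linear_rV_continuous _ _ _ L) df.
have E : {near (cmap p p : W), f =1 (fun y => f (c + L y))}.
  apply: (open_near op cp) => x px.
  have [_ px2] := (S1xM_cimgP p x).1 px.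
  have px' : cimg p (row_mx (lsubmx (cmap p p : W)) (rsubmx x)).
    apply/S1xM_cimgP; rewrite /tcoord row_mxKl row_mxKr; split=> //.
    by have [] := (S1xM_cimgP p (cmap p p)).1 cp.
  rewrite LE /f (S1xM_in_chart sm _ _ px) (S1xM_in_chart sm _ _ px').
  rewrite b_slice [RHS]b_slice /= row_mxKr; congr (b _ _).
apply: etrans (near_eq_derive _ E) _.
apply: etrans (deriveE _ d1) _.
apply: etrans (congr1 (fun h : W -> R => h ddt) d2) _.
have Ldt : L ddt = 0.
  by rewrite /L /= mul_row_block !mulmx0 mul0mx !addr0; exact: row_mx0.
exact: etrans (congr1 (fun h => 'd f _ h) Ldt) (linear0 _).
Qed.

Lemma b_horizontal (p : N) u w :
  b p (tnth [tuple horizontal u; horizontal w]) =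
  dext (contraction b) p.2 (tnth [tuple u; w]).
Proof.
have af := contraction_form; set a := contraction b.
have y0E : rsubmx (cmap p p : W) = cmap p.2 p.2 by rewrite row_mxKr.
have D e e' : 'D_(horizontal e') (fun x => in_chart b p x
    (tnth [tuple ddt; horizontal e])) (cmap p p) =
    'd (coef a p.2 ^~ e) (cmap p.2 p.2) e'.
  have dc : differentiable (coef a p.2 ^~ e) (rsubmx (cmap p p : W)).
    by rewrite y0E; exact: (coef_differentiable af _ (cimg_center sm _)).
  have [d1 d2] := diff_rsubmx dc.
  have E : {near (cmap p p : W), (fun x => in_chart b p x
    (tnth [tuple ddt; horizontal e])) =1 (fun y => coef a p.2 (rsubmx y) e)}.
    apply: (open_near (@S1xM_cimg_open _ _ _ sm p) (S1xM_cimg_center sm p)) => x px.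
    exact: coef_contraction.
  apply: etrans (near_eq_derive _ E) _.
  apply: etrans (deriveE _ d1) _.
  by apply: etrans (d2 _) _; rewrite y0E row_mxKr.
pose v : 'I_3 -> W := fun i => nth 0 [:: ddt; horizontal u; horizontal w] i.
have v0 : v ord0 = ddt by [].
have v1 : v (inord 1) = horizontal u by rewrite /v inordK.
have v2 : v ord_max = horizontal w by [].
have [_ ba] := b_bilinear p.
have := bclosed p v.
rewrite /Dtw (wedge_dt_2E sm _ ba) /dext.
rewrite (@big_I3 R (fun i => 'D_(v i) (fun x => in_chart b p x
  (fun j => v (lift i j))) (cmap p p))).
(* Only the first of the three vectors has a t-component, and the derivative along it vanishes; what
   remains is b(u, w) - D_u(a(w)) + D_w(a(u)) = 0. *)
rewrite ![fun j => v (lift _ j)]vec2E !lift_I3 v0 v1 v2 derive_orbit !D.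
rewrite /ddt tcoord_row_mx !tcoord0E !mul0r mul1r subr0 addr0 sub0r => H.
have aux (s t t' : R) : s + (- t + t') = 0 -> s = t - t' by move=> ?; lra.
exact: etrans (aux _ _ _ H) (esym (dext1E sm af p.2 (tnth [tuple u; w]))).
Qed.

Lemma Smap_contraction : Smap M (contraction b) = b.
Proof.
apply: funext => p; apply: funext => v.
rewrite (SmapE sm contraction_form) -b_horizontal /contraction -!(b_slice p).
have [bl ba] := b_bilinear p.
have bl' z k x y : b p (tnth [tuple k *: x + y; z]) =
    k * b p (tnth [tuple x; z]) + b p (tnth [tuple y; z]).
  by rewrite ba bl opprD -mulrN -!ba.
(* Both sides are bilinear, so it suffices to expand along d/dt and the horizontal vectors. *)
have vE (x : W) : x = tcoord x *: ddt + horizontal (rsubmx x).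
  rewrite /ddt /horizontal scale_row_mx scaler0 add_row_mx addr0 add0r.
  rewrite -[LHS]row_mx_tcoord; congr row_mx.
  by apply/rowP => i; rewrite !mxE mulr1.
have b00 : b p (tnth [tuple ddt; ddt]) = 0 by have := ba ddt ddt; lra.
rewrite [in RHS](vec2E v) [in RHS](vE (v ord0)) [in RHS](vE (v ord_max)).
rewrite bl' !bl b00 (ba (horizontal _) ddt).
ring.
Qed.

End Beta.

End Inverse.

Theorem mainTheorem4 (R : realType) (n : nat) (hn : (0 < n)%N)
    (M : charted R n.*2.-1) (hM : closed_manifold M) :
  set_bij (Cont M) (ISympD M) (Smap M).
Proof.
have [sm _ _] := hM.
have mE : n.*2.-1 = (1 + n.-1 * 2)%N by rewrite -{1}(prednK hn) doubleS muln2.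
split.
- move=> a [af ac]; split.
  + exact: Smap_form.
  + exact: Smap_invariant.
  + by apply/(Smap_nondegenerate sm mE af).
  + exact: Smap_closed.
- move=> a a'; rewrite !inE => -[af _] [af' _] E.
  by rewrite -(contraction_Smap sm af) -(contraction_Smap sm af') E.
- move=> b [bf binv bnd bclosed]; exists (contraction b).
    split; first exact: contraction_form.
    (* The contact condition on the contraction is the nondegeneracy of its image, which is [b]
       itself. *)
    apply/(Smap_nondegenerate sm mE (contraction_form sm bf binv)).
    by rewrite Smap_contraction.
  exact: Smap_contraction.
Qed.
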